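(* Let $G$ be a group, let $J$ be a set, and let $R\subseteq C(X_G)$ be a set each of whose elements is a finite linear combination $\sum_j\lambda_j\prod_{r,i}1_{r^i}$ of products of finitely many characteristic functions $1_{r^i}$ with $r^i\in\bigsqcup_{i\in I}G^i$. Then there is a $*$-isomorphism $\phi:C_{pr}^*(G,R)\rightarrow C(\Omega_R)\rtimes_\beta G$ such that $\phi([r])=1_r\delta_r$ for each $r\in G$ and $\phi(P_i)=1_{e^i}\delta_e$ for each $i\in J$.
   Context: Let $G$ be a group with neutral element $e$ and $J$ a set. The algebra $C_{pr}^*(G)$ (partial group algebra with projections) is the universal C*-algebra generated by $\{[g]:g\in G\}$ and $\{P_i\}_{i\in J}$ with the relations: $[e]=1$; $[r^{-1}]=[r]^*$; $[r][s][s^{-1}]=[rs][s^{-1}]$; $P_i^*=P_i=P_i^2$; $[r][r]^*$ and $[s]P_j[s]^*$ commute; $[r]P_i[r]^*$ and $[s]P_j[s]^*$ commute (for all $r,s\in G$, $i,j\in J$). The space $X_G$: let $I=J\sqcup\{0\}$. For each $i\in I$ let $G^i$ be a distinct copy of $G$; for $i\in J$ its elements are written $g^i$ ($g\in G$), and $G^0$ is identified with $G$, its elements being written $g$ (so $g^0=g$). Identify $\{0,1\}^{\bigsqcup_{i\in I}G^i}$ (product topology) with the set of subsets of $\bigsqcup_{i\in I}G^i$. Then $X_G$ is the compact subspace of all subsets $\xi$ such that $e\in\xi$ and, whenever $r^i\in\xi$, also $r\in\xi$. For $r^i\in\bigsqcup_{i\in I}G^i$, $1_{r^i}\in C(X_G)$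 is the characteristic function with $1_{r^i}(\xi)=1$ if $r^i\in\xi$ and $0$ otherwise; $1_r=1_{r^0}$. The algebra $C_{pr}^*(G,R)$ (partial group C*-algebra with projections and relations $R$) is the universal C*-algebra generated by $\{[g]:g\in G\}$ and $\{P_i\}_{i\in J}$ with all the relations defining $C_{pr}^*(G)$ together with $\sum_j\lambda_j\prod_{r,i}[r]P_i[r]^*=0$ for every $\sum_j\lambda_j\prod_{r,i}1_{r^i}\in R$, where $[r]P_0[r]^*$ means $[r][r]^*$. The partial action: for $t\in G$ let $X_t=\{\xi\in X_G: t\in\xi\}$ (clopen), and let $\theta_t:X_{t^{-1}}\to X_t$ be the homeomorphism $\theta_t(\xi)=t\xi=\{(tr)^i: r^i\in\xi\}$. Define $$\Omega_R=\{\xi\in X_G: f(t^{-1}\xi)=0\ \text{for all } t\in\xi\cap G,\ f\in R\}.$$ This is a compact subset of $X_G$, invariant under $\theta$, so $\theta_t$ restricts to a homeomorphism $X_{t^{-1}}\cap\Omega_R\to X_t\cap\Omega_R$. Put $D_t=C(X_t\cap\Omega_R)$, regarded as an ideal of $C(\Omega_R)$ (extension by zero), and $\beta_t:D_{t^{-1}}\to D_t$, $\beta_t(f)=f\circ\theta_{t^{-1}}$. This is a partial action of $G$ on $C(\Omega_R)$. The partial crossed product $C(\Omega_R)\rtimes_\beta G$ is the enveloping C*-algebra of the $*$-algebra of finite formal sums $\sum_g a_g\delta_g$, $a_g\in D_g$, with pointwise sum, product determined by $(a\delta_g)(b\delta_h)=\beta_g(\beta_{g^{-1}}(a)b)\delta_{gh}$,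 involution $(a\delta_g)^*=\beta_{g^{-1}}(a^* )\delta_{g^{-1}}$, and norm $\|\sum_g a_g\delta_g\|_1=\sum_g\|a_g\|$. In the formulas for $\phi$, $1_r$ and $1_{e^i}$ denote the restrictions of these functions to $\Omega_R$. *)

(* Defs.v *)
From HB Require Import structures.
From mathcomp Require Import all_boot all_order all_algebra.
From mathcomp Require Import all_classical all_reals topology normedtype.
From mathcomp Require Import finmap complex.

Set Implicit Arguments.
Unset Strict Implicit.
Unset Printing Implicit Defensive.

Import Order.TTheory GRing.Theory Num.Theory numFieldNormedType.Exports.
Local Open Scope classical_set_scope.
Local Open Scope ring_scope.
Local Open Scope complex_scope.

(* Algebras are not required to have a unit, and may be zero. *)
HB.mixin Record isStarAlgebra (K : realType) V of GRing.Lmodule K[i] V := {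
  smul : V -> V -> V;
  star : V -> V;
  smulA : associative smul;
  smulDl : left_distributive smul +%R;
  smulDr : right_distributive smul +%R;
  smulZl : forall (c : K[i]) (x y : V), smul (c *: x) y = c *: smul x y;
  smulZr : forall (c : K[i]) (x y : V), smul x (c *: y) = c *: smul x y;
  starK : involutive star;
  starD : {morph star : x y / x + y};
  starZ : forall (c : K[i]) (x : V), star (c *: x) = c^* *: star x;
  starM : forall x y : V, star (smul x y) = smul (star y) (star x)
}.

#[short(type="starAlgType")]
HB.structure Definition StarAlgebra (K : realType) :=
  {V of GRing.Lmodule K[i] V & isStarAlgebra K V}.

Notation "x ** y" := (smul x y) (at level 40, left associativity).

HB.mixin Record isCStarAlgebra (K : realType) A
    of CompleteNormedModule K[i] A & isStarAlgebra K A := {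
  norm_smul_le : forall x y : A, `|smul x y| <= `|x| * `|y|;
  norm_cstar : forall x : A, `|smul (star x) x| = `|x| ^+ 2
}.

#[short(type="cstarAlgType")]
HB.structure Definition CStarAlgebra (K : realType) :=
  {A of CompleteNormedModule K[i] A & isStarAlgebra K A & isCStarAlgebra K A}.

Definition star_hom (K : realType) (V W : starAlgType K) (f : V -> W) : Prop :=
  [/\ linear f, {morph f : x y / x ** y} & {morph f : x / star x}].

Definition star_iso (K : realType) (V W : starAlgType K) (f : V -> W) : Prop :=
  star_hom f /\ bijective f.

(* Norms of K[i]-modules take their values in the nonnegative part of K[i]. *)
Definition rnorm (K : realType) (V : normedModType K[i]) (x : V) : K :=
  complex.Re `|x|.

(* B is the Hausdorff completion of L for the seminorm
   sup {‖pi x‖ | pi a *-representation of L contractive for nrm}. By the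
   Gelfand-Naimark theorem, representations in C*-algebras and on Hilbert
   spaces give the same supremum. *)
Definition is_enveloping (K : realType) (L : starAlgType K) (nrm : L -> K)
    (B : cstarAlgType K) (iota : L -> B) : Prop :=
  [/\ star_hom iota,
      dense (range iota)
    & forall x, rnorm (iota x) =
        sup [set s | exists (C : cstarAlgType K) (pi : L -> C),
               [/\ star_hom pi, forall y, rnorm (pi y) <= nrm y
                 & s = rnorm (pi x)]]].

Section Space.
Variables (K : realType) (G : groupType) (J : Type).

(* (r, None) stands for r^0 = r, and (r, Some i) for r^i with i in J. *)
Definition symb : Type := G * option J.

Definition subsets : topologicalType := prod_topology (fun _ : symb => bool).

Definition XG : set subsets :=
  [set xi | xi (1%g, None) /\ forall r i, xi (r, Some i) -> xi (r, None)].

(* shift t xi = {(t r)^i | r^i in xi} *)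
Definition shift (t : G) (xi : subsets) : subsets :=
  fun x => xi ((t^-1 * x.1)%g, x.2).

Definition char_fun (x : symb) (xi : subsets) : K[i] := (xi x)%:R.

(* The formal expression \sum_j lambda_j \prod_(r, i) 1_(r^i), listed by its
   terms. *)
Definition expr : Type := seq (K[i] * seq symb).

Definition expr_fun (p : expr) (xi : subsets) : K[i] :=
  \sum_(m <- p) m.1 * \prod_(x <- m.2) char_fun x xi.

(* An element of C(XG) is represented by any function on the ambient space
   that agrees with it on XG; a set of relations is a set of such functions. *)
Definition represents (p : expr) (f : subsets -> K[i]) : Prop :=
  forall xi, XG xi -> f xi = expr_fun p xi.

Variable R : set (subsets -> K[i]).

Definition Omega : set subsets :=
  [set xi | XG xi /\
    forall t, xi (t, None) -> forall f, R f -> f (shift t^-1%g xi) = 0].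

(* C(X_t `&` Omega), its elements being extended by zero to the whole ambient
   space. *)
Definition ideal (t : G) : set (subsets -> K[i]) :=
  [set f | {within Omega, continuous (f : subsets -> K[i]^o)} /\
    forall xi, ~ (Omega xi /\ xi (t, None)) -> f xi = 0].

(* On ideal t^-1 this is the isomorphism onto ideal t: the extension by zero
   of f makes f \o shift t^-1 vanish off X_t `&` Omega. *)
Definition beta (t : G) (f : subsets -> K[i]) : subsets -> K[i] :=
  f \o shift t^-1%g.

Definition char_Omega (x : symb) (xi : subsets) : K[i] :=
  if `[< Omega xi >] then char_fun x xi else 0.

Definition sup_norm (f : subsets -> K[i]) : K :=
  sup (range (fun xi => rnorm (f xi : K[i]^o))).

(* The formal sum \sum_g a_g delta_g is the function g |-> a_g. *)
Definition formal_sum : pred (G -> subsets -> K[i]) := fun a =>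
  `[< (forall g, ideal g (a g)) /\ finite_set [set g | a g != 0] >].

Definition fs_mul (a b : G -> subsets -> K[i]) : G -> subsets -> K[i] :=
  fun k xi => \sum_(g \in [set: G])
    beta g (beta g^-1%g (a g) \* b (g^-1 * k)%g) xi.

Definition fs_star (a : G -> subsets -> K[i]) : G -> subsets -> K[i] :=
  fun k => beta k (fun xi => (a k^-1%g xi)^*).

Definition fs_delta (g : G) (a : subsets -> K[i]) : G -> subsets -> K[i] :=
  fun h => if h == g then a else 0.

Lemma shiftM s t xi : shift s (shift t xi) = shift (s * t)%g xi.
Proof. by apply/funext => -[r i]; rewrite /shift /= invgM mulgA. Qed.

Lemma shift1 xi : shift 1%g xi = xi.
Proof. by apply/funext => -[r i]; rewrite /shift /= invg1 mul1g. Qed.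

Lemma Omega_shift t xi :
  Omega xi -> xi (t, None) -> Omega (shift t^-1%g xi).
Proof.
move=> [[xi1 xiP] OR] xit; split.
  split=> [|r i]; rewrite /shift /= invgK; first by rewrite mulg1.
  exact: xiP.
move=> s xits f Rf; rewrite shiftM -invgM; apply: OR => //.
by move: xits; rewrite /shift /= invgK.
Qed.

Lemma shift_Omega t xi :
  Omega (shift t^-1%g xi) -> shift t^-1%g xi (t^-1%g, None) ->
  Omega xi /\ xi (t, None).
Proof.
move=> O1 O2; have := Omega_shift O1 O2.
rewrite invgK shiftM mulgV shift1 => O3; split=> //.
case: O1 => -[+ _] _; by rewrite /shift /= invgK mulg1.
Qed.

Lemma subsets_coord_cvg (x : symb) (xi : subsets) :
  (fun eta : subsets => eta x) @ nbhs xi --> xi x.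
Proof. exact: (@proj_continuous {classic symb} (fun=> bool) x). Qed.

Lemma near_coord (x : symb) (xi : subsets) :
  \forall eta \near nbhs xi, eta x = xi x.
Proof.
have := @subsets_coord_cvg x xi [set xi x].
apply; exact: discrete_set1.
Qed.

Lemma shift_continuous t : continuous (shift t).
Proof.
move=> xi; apply/cvg_sup => x A /= [B [[C oC <-] Cx] BA].
have := near_coord ((t^-1 * x.1)%g, x.2) xi.
by apply: filterS => eta etaE; apply: BA => /=; rewrite /shift etaE.
Qed.

Lemma within_shift_cvg t xi (f : subsets -> K[i]) :
    {within Omega, continuous (f : subsets -> K[i]^o)} ->
  Omega xi -> xi (t, None) ->
  beta t f @ within Omega (nbhs xi) --> (beta t f xi : K[i]^o).
Proof.
move=> /subspace_continuousP fC Oxi xit.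
have Os := Omega_shift Oxi xit.
move=> A /(fC _ Os) fA.
have {fA}sA : \forall eta \near nbhs xi,
    Omega (shift t^-1%g eta) -> A (beta t f eta).
  exact: (@shift_continuous t^-1%g xi _ fA).
apply: filterS2 sA (near_coord (t, None) xi) => eta + etaE Oeta; apply.
by apply: Omega_shift => //; rewrite etaE.
Qed.

Lemma ideal_beta t f : ideal t^-1%g f -> ideal t (beta t f).
Proof.
move=> [fC f0]; split; last first.
  move=> xi nO; rewrite /beta /=; apply: f0 => -[O1 O2]; apply: nO.
  exact: shift_Omega.
apply/subspace_continuousP => xi Oxi.
have [xit|xit] := boolP (xi (t, None)); first exact: within_shift_cvg.
have E0 eta : ~~ eta (t, None) -> beta t f eta = 0.
  move=> h; apply: f0 => -[O1 O2]; case: (shift_Omega O1 O2) => _.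
  exact/negP.
move=> A /nbhs_singleton Axi; have A0 : A 0 by rewrite -(E0 _ xit).
apply: filterS (near_coord (t, None) xi) => eta etaE _.
by change (A (beta t f eta)); rewrite E0 // etaE.
Qed.

Lemma ideal0 t : ideal t 0.
Proof.
by split=> // ; apply/subspace_continuousP => xi _; exact: cvg_cst.
Qed.

Lemma ideal_lin t c f g : ideal t f -> ideal t g -> ideal t (c *: f + g).
Proof.
move=> [fC f0] [gC g0]; split; last first.
  move=> xi nO; rewrite !fctE f0 // g0 //; by rewrite scaler0 addr0.
move/subspace_continuousP: fC => fC; move/subspace_continuousP: gC => gC.
apply/subspace_continuousP => xi Oxi.
apply: (@cvgD _ K[i]^o); last exact: gC.
by apply: (@cvgZl_tmp _ K[i]^o); exact: fC.
Qed.

Lemma ideal_mul t f g : ideal t f ->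
  {within Omega, continuous (g : subsets -> K[i]^o)} -> ideal t (f \* g).
Proof.
move=> [fC f0] gC; split; last first.
  by move=> xi nO; rewrite /= f0 // mul0r.
move/subspace_continuousP: fC => fC; move/subspace_continuousP: gC => gC.
apply/subspace_continuousP => xi Oxi.
by apply: (@cvgM K[i]); [exact: fC | exact: gC].
Qed.

Lemma ideal_conj t f : ideal t f -> ideal t (fun xi => (f xi)^*).
Proof.
move=> [fC f0]; split; last by move=> xi nO; rewrite f0 // conjc0.
move/subspace_continuousP: fC => fC; apply/subspace_continuousP => xi Oxi.
apply/(@cvgrPdist_lt K[i] K[i]^o) => e e0.
have /(@cvgrPdist_lt K[i] K[i]^o) /(_ e e0) := fC _ Oxi.
by apply: filterS => eta; rewrite -rmorphB norm_conjC.
Qed.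

Lemma char_Omega_continuous x :
  {within Omega, continuous (char_Omega x : subsets -> K[i]^o)}.
Proof.
apply/subspace_continuousP => xi Oxi A /nbhs_singleton Ax.
apply: filterS (near_coord x xi) => eta etaE Oeta.
have E : char_Omega x xi = char_Omega x eta.
  by rewrite /char_Omega /char_fun etaE !asboolT.
by change (A (char_Omega x eta)); rewrite -E.
Qed.

Lemma ideal_sum t (I : Type) (s : seq I) (F : I -> subsets -> K[i]) :
  (forall i, ideal t (F i)) -> ideal t (fun xi => \sum_(i <- s) F i xi).
Proof.
move=> iF; elim: s => [|i s IH].
  by have := ideal0 t; congr ideal; apply/funext => xi; rewrite big_nil.
have := ideal_lin 1 (iF i) IH; congr ideal; apply/funext => xi.
by rewrite big_cons scale1r.
Qed.

Lemma formal_sum_supp a : formal_sum a ->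
  exists s : {fset G}, forall g, g \notin s -> a g = 0.
Proof.
move=> /asboolP[_ fa]; exists (fset_set [set g | a g != 0]) => g.
by rewrite in_fset_set // notin_setE /= => /negP; rewrite negbK => /eqP.
Qed.

Lemma supp_formal_sum a (s : {fset G}) : (forall g, ideal g (a g)) ->
  (forall g, g \notin s -> a g = 0) -> formal_sum a.
Proof.
move=> ia a0; apply/asboolP; split=> //.
apply: (finite_subfset s) => g /=; apply: contraR => /a0 ->; exact: eqxx.
Qed.

Lemma formal_sum_ideal a g : formal_sum a -> ideal g (a g).
Proof. by move=> /asboolP[]. Qed.

Lemma fs_term a b g k xi :
  beta g (beta g^-1%g (a g) \* b (g^-1 * k)%g) xi =
  a g xi * b (g^-1 * k)%g (shift g^-1%g xi).
Proof. by rewrite /beta /= invgK shiftM mulgV shift1. Qed.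

Lemma fs_mul_seq (s : {fset G}) a b k xi : (forall g, g \notin s -> a g = 0) ->
  fs_mul a b k xi =
  \sum_(g <- s) a g xi * b (g^-1 * k)%g (shift g^-1%g xi).
Proof.
move=> a0; rewrite /fs_mul (fsbigTE s).
  by apply: eq_bigr => g _; rewrite fs_term.
by move=> g /a0 ag0; rewrite fs_term ag0 mul0r.
Qed.

Lemma fs_mul_ideal a b g k : formal_sum a -> formal_sum b ->
  ideal k (beta g (beta g^-1%g (a g) \* b (g^-1 * k)%g)).
Proof.
move=> fa fb; have ia := formal_sum_ideal g fa.
have ib := formal_sum_ideal (g^-1 * k)%g fb.
have [bC _] : ideal g (beta g (beta g^-1%g (a g) \* b (g^-1 * k)%g)).
  apply: ideal_beta; apply: ideal_mul; last by case: ib.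
  by apply: ideal_beta; rewrite invgK.
split=> // xi nO; rewrite fs_term.
have [O1|/(proj2 ia) ->] := pselect (Omega xi /\ xi (g, None)); last first.
  by rewrite mul0r.
rewrite (proj2 ib) ?mulr0 // => -[O2 xk]; apply: nO; split; first by case: O1.
by move: xk; rewrite /shift /= invgK mulVKg.
Qed.

Lemma formal_sum_mul a b :
  formal_sum a -> formal_sum b -> formal_sum (fs_mul a b).
Proof.
move=> fa fb; have [s a0] := formal_sum_supp fa.
have [t b0] := formal_sum_supp fb.
apply: (@supp_formal_sum _ [fset (g * h)%g | g in s, h in t]%fset) => k.
  have -> : fs_mul a b k = fun xi => \sum_(g <- s)
      beta g (beta g^-1%g (a g) \* b (g^-1 * k)%g) xi.
    apply/funext => xi; rewrite (fs_mul_seq _ _ _ a0).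
    by apply: eq_bigr => g _; rewrite fs_term.
  by apply: ideal_sum => g; exact: fs_mul_ideal.
move=> kst; apply/funext => xi; rewrite (fs_mul_seq _ _ _ a0) big_seq big1 //.
move=> g gs; rewrite (b0 (g^-1 * k)%g) ?mulr0 //; apply: contra kst => gkt.
by apply/imfset2P; exists g => //; exists (g^-1 * k)%g; rewrite // mulVKg.
Qed.

Lemma formal_sum_star a : formal_sum a -> formal_sum (fs_star a).
Proof.
move=> fa; have [s a0] := formal_sum_supp fa.
apply: (@supp_formal_sum _ [fset g^-1%g | g in s]%fset) => k.
  by apply: ideal_beta; apply: ideal_conj; exact: formal_sum_ideal.
move=> ks; apply/funext => xi; rewrite /fs_star /beta /= a0 ?conjc0 //.
apply: contra ks => ks; apply/imfsetP; exists k^-1%g => //.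
by rewrite invgK.
Qed.

Lemma formal_sum_delta g a : ideal g a -> formal_sum (fs_delta g a).
Proof.
move=> ia; apply: (@supp_formal_sum _ [fset g]%fset) => h; rewrite /fs_delta.
  by case: eqP => [->//|_]; exact: ideal0.
by rewrite inE => /negbTE ->.
Qed.

Lemma formal_sum_submod : submod_closed formal_sum.
Proof.
split=> [|c a b fa fb]; rewrite /in_mem /=.
  by apply: (@supp_formal_sum _ fset0) => // g; exact: ideal0.
have [s a0] := formal_sum_supp fa; have [t b0] := formal_sum_supp fb.
apply: (@supp_formal_sum _ (s `|` t)%fset) => g.
  by apply: ideal_lin; exact: formal_sum_ideal.
rewrite inE negb_or => /andP[/a0 ag /b0 bg]; apply/funext => xi.
by rewrite !fctE ag bg scaler0 addr0.
Qed.

Lemma char_Omega_ideal0 r : ideal r (char_Omega (r, None)).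
Proof.
split; last first.
  move=> xi; rewrite /char_Omega; case: asboolP => // Oxi nO.
  by rewrite /char_fun; case: (boolP (xi _)) => // xir; case: nO.
exact: char_Omega_continuous.
Qed.

Lemma char_Omega_ideal i : ideal 1%g (char_Omega (1%g, Some i)).
Proof.
split; first exact: char_Omega_continuous.
move=> xi; rewrite /char_Omega; case: asboolP => // Oxi [].
by split=> //; case: Oxi => -[].
Qed.

Lemma fs_mulA a b c : formal_sum a -> formal_sum b ->
  fs_mul a (fs_mul b c) = fs_mul (fs_mul a b) c.
Proof.
move=> fa fb; have [s a0] := formal_sum_supp fa.
have [t b0] := formal_sum_supp fb.
pose st := [fset (g * h)%g | g in s, h in t]%fset.
have ab0 m : m \notin st -> forall g, g \in s -> b (g^-1 * m)%g = 0.
  move=> mst g gs; apply: b0; apply: contra mst => gmt.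
  by apply/imfset2P; exists g => //; exists (g^-1 * m)%g; rewrite // mulVKg.
have abm0 m : m \notin st -> fs_mul a b m = 0.
  move=> mst; apply/funext => xi; rewrite (fs_mul_seq _ _ _ a0) big_seq big1 //.
  by move=> g gs; rewrite (ab0 m) // mulr0.
apply/funext => k; apply/funext => xi.
rewrite (fs_mul_seq _ _ _ a0) (fs_mul_seq _ _ _ abm0).
under [RHS]eq_bigr do rewrite (fs_mul_seq _ _ _ a0) mulr_suml.
rewrite exchange_big /= [LHS]big_seq [RHS]big_seq; apply: eq_bigr => g gs.
under [RHS]eq_bigr do rewrite -mulrA; rewrite -mulr_sumr; congr (_ * _).
rewrite -(fsbigTE st (fun m => b (g^-1 * m)%g (shift g^-1%g xi) *
                         c (m^-1 * k)%g (shift m^-1%g xi))); last first.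
  by move=> m mst; rewrite (ab0 m) // mul0r.
rewrite (reindex_fsbigT (fun h : G => (g * h)%g)); last first.
  by exists (fun h => (g^-1 * h)%g) => h; rewrite ?mulKg ?mulVKg.
by apply: eq_fsbigr => h _; rewrite fs_term shiftM mulKg !invgM mulgA.
Qed.

Lemma fs_mulDl a b c : formal_sum a -> formal_sum b ->
  fs_mul (a + b) c = fs_mul a c + fs_mul b c.
Proof.
move=> fa fb; have [s a0] := formal_sum_supp fa.
have [t b0] := formal_sum_supp fb.
pose st := (s `|` t)%fset.
have a0' g : g \notin st -> a g = 0.
  by rewrite inE negb_or => /andP[/a0].
have b0' g : g \notin st -> b g = 0.
  by rewrite inE negb_or => /andP[_ /b0].
have ab0 g : g \notin st -> (a + b) g = 0.
  by move=> gst; rewrite fctE a0' // b0' // addr0.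
apply/funext => k; apply/funext => xi; rewrite !fctE.
rewrite (fs_mul_seq _ _ _ ab0) (fs_mul_seq _ _ _ a0') (fs_mul_seq _ _ _ b0').
by rewrite -big_split; apply: eq_bigr => g _; exact: mulrDl.
Qed.

Lemma fs_mulDr a b c : formal_sum a ->
  fs_mul a (b + c) = fs_mul a b + fs_mul a c.
Proof.
move=> fa; have [s a0] := formal_sum_supp fa.
apply/funext => k; apply/funext => xi; rewrite !fctE !(fs_mul_seq _ _ _ a0).
by rewrite -big_split; apply: eq_bigr => g _; exact: mulrDr.
Qed.

Lemma fs_mulZl x a b : formal_sum a -> fs_mul (x *: a) b = x *: fs_mul a b.
Proof.
move=> fa; have [s a0] := formal_sum_supp fa.
have xa0 g : g \notin s -> (x *: a) g = 0.
  by move=> /a0 E; rewrite fctE E scaler0.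
apply/funext => k; apply/funext => xi; rewrite !fctE.
rewrite (fs_mul_seq _ _ _ a0) (fs_mul_seq _ _ _ xa0).
by rewrite scaler_sumr; apply: eq_bigr => g _; exact: esym (mulrA _ _ _).
Qed.

Lemma fs_mulZr x a b : formal_sum a -> fs_mul a (x *: b) = x *: fs_mul a b.
Proof.
move=> fa; have [s a0] := formal_sum_supp fa.
apply/funext => k; apply/funext => xi; rewrite !fctE !(fs_mul_seq _ _ _ a0).
by rewrite scaler_sumr; apply: eq_bigr => g _; exact: mulrCA.
Qed.

Lemma fs_starK : involutive fs_star.
Proof.
move=> a; apply/funext => k; apply/funext => xi.
by rewrite /fs_star /beta /= conjcK !invgK shiftM mulgV shift1.
Qed.

Lemma fs_starD : {morph fs_star : a b / a + b}.
Proof.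
by move=> a b; apply/funext => k; apply/funext => xi; exact: rmorphD.
Qed.

Lemma fs_starZ x a : fs_star (x *: a) = x^* *: fs_star a.
Proof. by apply/funext => k; apply/funext => xi; exact: rmorphM. Qed.

Lemma fs_starM a b : formal_sum a ->
  fs_star (fs_mul a b) = fs_mul (fs_star b) (fs_star a).
Proof.
move=> fa; have [s a0] := formal_sum_supp fa.
apply/funext => k; apply/funext => xi.
rewrite {1}/fs_star /beta /= (fs_mul_seq _ _ _ a0) rmorph_sum /=.
pose F (g : G) := (a g (shift k^-1%g xi) *
  b (g^-1 * k^-1)%g (shift g^-1%g (shift k^-1%g xi)))^*.
rewrite -(fsbigTE s F) /F; last by move=> g gs; rewrite a0 // mul0r conjc0.
rewrite [RHS](reindex_fsbigT (fun h : G => (k * h)%g)); last first.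
  by exists (fun h => (k^-1 * h)%g) => h; rewrite ?mulKg ?mulVKg.
apply: eq_fsbigr => h _; rewrite fs_term /fs_star /beta /= rmorphM mulrC.
have -> : (((k * h)^-1 * k)^-1 = h)%g by rewrite invgM invgK mulKg.
by rewrite !shiftM !invgM mulVKg.
Qed.

End Space.

Section PartialCrossedProduct.
Variables (K : realType) (G : groupType) (J : Type).
Variable R : set (subsets G J -> K[i]).

(* The *-algebra of finite formal sums \sum_g a_g delta_g with a_g in
   ideal R g. *)
Record crossed_alg := CrossedAlg {
  coeffs :> G -> subsets G J -> K[i];
  coeffsP : formal_sum R coeffs
}.

HB.instance Definition _ := [isSub for coeffs].
HB.instance Definition _ := [Choice of crossed_alg by <:].
HB.instance Definition _ :=
  GRing.SubChoice_isSubLmodule.Build _ _ _ crossed_alg (formal_sum_submod R).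

Definition crossed_mul (a b : crossed_alg) : crossed_alg :=
  CrossedAlg (formal_sum_mul (coeffsP a) (coeffsP b)).

Definition crossed_star (a : crossed_alg) : crossed_alg :=
  CrossedAlg (formal_sum_star (coeffsP a)).

Definition delta (g : G) (a : subsets G J -> K[i]) (ga : ideal R g a) :
    crossed_alg :=
  CrossedAlg (formal_sum_delta ga).

Let crossed_mulA : associative crossed_mul.
Proof. move=> a b c; apply: val_inj.
exact: (fs_mulA (coeffs c) (coeffsP a) (coeffsP b)). Qed.

Let crossed_mulDl : left_distributive crossed_mul +%R.
Proof. move=> a b c; apply: val_inj.
exact: (fs_mulDl (coeffs c) (coeffsP a) (coeffsP b)). Qed.

Let crossed_mulDr : right_distributive crossed_mul +%R.
Proof. move=> a b c; apply: val_inj.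
exact: (fs_mulDr (coeffs b) (coeffs c) (coeffsP a)). Qed.

Let crossed_mulZl (x : K[i]) a b :
  crossed_mul (x *: a) b = x *: crossed_mul a b.
Proof. by apply: val_inj; exact: (fs_mulZl x (coeffs b) (coeffsP a)). Qed.

Let crossed_mulZr (x : K[i]) a b :
  crossed_mul a (x *: b) = x *: crossed_mul a b.
Proof. by apply: val_inj; exact: (fs_mulZr x (coeffs b) (coeffsP a)). Qed.

Let crossed_starK : involutive crossed_star.
Proof. by move=> a; apply: val_inj; exact: (fs_starK (coeffs a)). Qed.

Let crossed_starD : {morph crossed_star : a b / a + b}.
Proof. by move=> a b; apply: val_inj; exact: (fs_starD (coeffs a) (coeffs b)). Qed.

Let crossed_starZ (x : K[i]) a :
  crossed_star (x *: a) = x^* *: crossed_star a.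
Proof. by apply: val_inj; exact: (fs_starZ x (coeffs a)). Qed.

Let crossed_starM a b :
  crossed_star (crossed_mul a b) = crossed_mul (crossed_star b) (crossed_star a).
Proof. by apply: val_inj; exact: (fs_starM (coeffs b) (coeffsP a)). Qed.

HB.instance Definition _ := @isStarAlgebra.Build K crossed_alg
  crossed_mul crossed_star crossed_mulA crossed_mulDl crossed_mulDr
  crossed_mulZl crossed_mulZr crossed_starK crossed_starD crossed_starZ
  crossed_starM.

Definition crossed_norm1 (a : crossed_alg) : K :=
  \sum_(g \in [set: G]) sup_norm (a g).

(* (B, iota) is the partial crossed product C(Omega_R) x|_beta G, together
   with the canonical map from the formal sums into it. *)
Definition is_partial_crossed_product (B : cstarAlgType K)
    (iota : crossed_alg -> B) : Prop :=
  is_enveloping crossed_norm1 iota.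

End PartialCrossedProduct.

Arguments delta {K G J R} g a ga.

Section PartialGroupAlgebra.
Variables (K : realType) (G : groupType) (J : Type).

Definition commute_in (A : cstarAlgType K) (x y : A) : Prop :=
  x ** y = y ** x.

(* [r] P_i [r]^*, where [r] P_0 [r]^* means [r] [r]^*. *)
Definition symb_elt (A : cstarAlgType K) (u : G -> A) (P : J -> A)
    (x : symb G J) : A :=
  match x.2 with
  | None => u x.1 ** star (u x.1)
  | Some i => u x.1 ** P i ** star (u x.1)
  end.

(* The empty product is the unit [e]. *)
Definition expr_elt (A : cstarAlgType K) (u : G -> A) (P : J -> A)
    (p : expr K G J) : A :=
  \sum_(m <- p) m.1 *:
    foldr (fun x y => symb_elt u P x ** y) (u 1%g) m.2.

Record pr_relations (A : cstarAlgType K) (u : G -> A) (P : J -> A) : Prop := {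
  (* [e] = 1 *)
  pr_unit : forall x, u 1%g ** x = x /\ x ** u 1%g = x;
  pr_inv : forall r, u r^-1%g = star (u r);
  pr_mul : forall r s, u r ** u s ** u s^-1%g = u (r * s)%g ** u s^-1%g;
  pr_proj : forall i, star (P i) = P i /\ P i = P i ** P i;
  pr_comm0 : forall r s j, commute_in (u r ** star (u r))
                                      (u s ** P j ** star (u s));
  pr_comm : forall r s i j, commute_in (u r ** P i ** star (u r))
                                       (u s ** P j ** star (u s))
}.

Variable R : set (subsets G J -> K[i]).

(* An element of R may have several expressions; the relation is imposed for
   each of them. *)
Definition pr_relations_R (A : cstarAlgType K) (u : G -> A) (P : J -> A) :
    Prop :=
  pr_relations u P /\
  forall f p, R f -> represents p f -> expr_elt u P p = 0.

(* (A, u, P) is the universal C*-algebra C*_pr(G, R) with its generators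
   [r] = u r and P_i = P i. *)
Definition is_Cpr (A : cstarAlgType K) (u : G -> A) (P : J -> A) : Prop :=
  pr_relations_R u P /\
  forall (B : cstarAlgType K) (v : G -> B) (Q : J -> B), pr_relations_R v Q ->
    exists! phi : A -> B,
      [/\ star_hom phi, forall r, phi (u r) = v r & forall i, phi (P i) = Q i].

End PartialGroupAlgebra.

(* Main.v *)
Require Import Defs.
From mathcomp Require Import all_boot all_order all_algebra.
From mathcomp Require Import all_classical all_reals topology normedtype.
From mathcomp Require Import sequences finmap complex.
From mathcomp Require Import ring lra.

(** Let [A] be any C*-algebra with elements [[r]] and [P_i] satisfying the
    relations. The projections [e_r = [r][r]^*] and [e_(r^i) = [r] P_i [r]^*]
    commute, and [[g] e_x = e_(gx) [g]] for every symbol [x] ([gen_symb]). Hence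
    the products of such projections with one generator are closed under
    multiplication and adjoint, by the same rules as the elements
    [\prod_x 1_x 1_g delta_g] of the crossed product. The isomorphism matches
    these two families of monomials, and the work is to make the matching
    continuous in both directions.

    From the crossed product to [A]: an expression in the projections [e_x] has
    norm at most the maximum over Omega of the corresponding function
    ([rnorm_expr]). Indeed a projection commuting with an element cuts it into
    two pieces, one of which keeps its norm ([rnorm_cut]); doing this for every
    symbol and using the compactness of the cube ([compact_choice]) yields a
    subset [xi] of symbols such that the element keeps its norm on every finite
    atom around [xi]. These atoms are therefore nonzero, which forces [xi] to
    lie in Omega, because a violated condition kills an atom; and on a small
    atom the element is the scalar value of the function at [xi]. This is where
    Omega, and the invariance built into it, comes from the relations. Since
    expressions are uniformly dense in the continuous functions on Omega
    ([expr_fun_dense]), monomials determine a contractive representation of the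
    algebra of all formal sums on [A] ([integrated_form]), hence of its
    enveloping C*-algebra ([enveloping_extend]).

    From [A] to the crossed product, when [A] is universal: the monomials in
    the crossed product satisfy the relations ([cross_relations]), which gives
    a *-homomorphism. It is contractive, as are all *-homomorphisms of unital
    C*-algebras: a self-adjoint [a] with norm below 1 is the average of the
    two unitaries [a + i sqrt (1 - a^2)] and [a - i sqrt (1 - a^2)]
    ([star_hom_contractive]).

    One composite is the identity by the uniqueness part of the universal
    property of [A]; the other is continuous and fixes the monomials, whose
    span is dense. *)

Set Implicit Arguments.
Unset Strict Implicit.
Unset Printing Implicit Defensive.

Import Order.TTheory GRing.Theory Num.Theory numFieldNormedType.Exports.
Local Open Scope classical_set_scope.
Local Open Scope ring_scope.
Local Open Scope complex_scope.

(** * Real-valued norms and *-algebra identities *)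

Section Norm.
Variable K : realType.

Lemma normc_rnorm (V : normedModType K[i]) (x : V) : `|x| = (rnorm x)%:C.
Proof.
have : `|x| \is Num.real by exact: normr_real.
by move=> /RRe_real <-.
Qed.

Section NormedModule.
Variable V : normedModType K[i].
Implicit Types x y : V.

Lemma rnorm_ge0 x : 0 <= rnorm x.
Proof. by rewrite -lecR -normc_rnorm normr_ge0. Qed.

Lemma rnorm_eq0 x : rnorm x = 0 -> x = 0.
Proof. by move=> x0; apply: normr0_eq0; rewrite normc_rnorm x0 rmorph0. Qed.

Lemma rnorm0 : rnorm (0 : V) = 0.
Proof. by rewrite /rnorm normr0. Qed.

Lemma rnormN x : rnorm (- x) = rnorm x.
Proof. by rewrite /rnorm normrN. Qed.

Lemma rnormB x y : rnorm (x - y) = rnorm (y - x).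
Proof. by rewrite /rnorm distrC. Qed.

Lemma rnormD x y : rnorm (x + y) <= rnorm x + rnorm y.
Proof. by rewrite -lecR rmorphD /= -!normc_rnorm ler_normD. Qed.

Lemma rnorm_triangle z x y : rnorm (x - y) <= rnorm (x - z) + rnorm (z - y).
Proof. by rewrite -[x - y](subrKA z) rnormD. Qed.

Lemma rnormZ (c : K[i]) x : rnorm (c *: x) = complex.Re `|c| * rnorm x.
Proof.
apply: complexI; rewrite -normc_rnorm normrZ rmorphM /= -normc_rnorm.
by congr (_ * _); rewrite RRe_real // normr_real.
Qed.

Lemma rnorm_sum (I : Type) (s : seq I) (F : I -> V) :
  rnorm (\sum_(i <- s) F i) <= \sum_(i <- s) rnorm (F i).
Proof.
elim: s => [|i s IH]; first by rewrite !big_nil rnorm0.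
by rewrite !big_cons (le_trans (rnormD _ _)) // lerD2l.
Qed.

Lemma rnorm_dense (D : set V) : dense D ->
  forall x (e : K), 0 < e -> exists2 y, D y & rnorm (x - y) < e.
Proof.
move=> dD x e e0; have eC0 : (0 : K[i]) < e%:C by rewrite ltcR.
have [|y [/= xy Dy]] := dD (ball x e%:C) _ (ball_open x e%:C).
  by exists x; exact: ballxx.
by exists y => //; move: xy; rewrite -ball_normE /= normc_rnorm ltcR.
Qed.

End NormedModule.

Lemma rnorm_complete (V : completeNormedModType K[i]) (x : nat -> V) :
  (forall e : K, 0 < e -> exists N, forall n m, (N <= n)%N -> (N <= m)%N ->
    rnorm (x n - x m) < e) ->
  exists l, forall e : K, 0 < e -> exists N, forall n, (N <= n)%N ->
    rnorm (x n - l) < e.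
Proof.
move=> cx; have : cvg (x @ \oo).
  apply/cauchy_cvgP/cauchy_exP => e; case: e => a b.
  rewrite ltcE /= => /andP[/eqP -> a0].
  have [N HN] := cx _ a0; exists (x N).
  exists N => // n /= Nn; rewrite -ball_normE /= normc_rnorm ltcR.
  exact: HN.
move=> cvx; exists (lim (x @ \oo)) => e e0.
have /cvgrPdist_lt /(_ e%:C) : x @ \oo --> lim (x @ \oo) by [].
rewrite ltcR => /(_ e0)[N _ HN]; exists N => n Nn.
by have := HN _ Nn; rewrite /= normc_rnorm ltcR rnormB.
Qed.

Section CStar.
Variable A : cstarAlgType K.
Implicit Types x y : A.

Lemma rnormM x y : rnorm (x ** y) <= rnorm x * rnorm y.
Proof. by rewrite -lecR rmorphM /= -!normc_rnorm norm_smul_le. Qed.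

Lemma rnorm_cstar x : rnorm (star x ** x) = rnorm x ^+ 2.
Proof. by apply: complexI; rewrite rmorphXn /= -!normc_rnorm norm_cstar. Qed.

End CStar.

Section StarAlgebra.
Variable V : starAlgType K.
Implicit Types x y z : V.

Lemma smul0l x : 0 ** x = 0.
Proof. by have := smulZl 0 (0 : V) x; rewrite !scale0r. Qed.
Lemma smul0r x : x ** 0 = 0.
Proof. by have := smulZr 0 x (0 : V); rewrite !scale0r. Qed.
Lemma smulNl x y : (- x) ** y = - (x ** y).
Proof. by rewrite -scaleN1r smulZl scaleN1r. Qed.
Lemma smulNr x y : x ** (- y) = - (x ** y).
Proof. by rewrite -scaleN1r smulZr scaleN1r. Qed.
Lemma smulBl x y z : (x - y) ** z = x ** z - y ** z.
Proof. by rewrite smulDl smulNl. Qed.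
Lemma smulBr x y z : z ** (x - y) = z ** x - z ** y.
Proof. by rewrite smulDr smulNr. Qed.
Lemma star0 : star (0 : V) = 0.
Proof. by have := starZ 0 (0 : V); rewrite rmorph0 !scale0r. Qed.
Lemma starN x : star (- x) = - star x.
Proof. by rewrite -scaleN1r starZ rmorphN1 scaleN1r. Qed.
Lemma starB x y : star (x - y) = star x - star y.
Proof. by rewrite starD starN. Qed.
Lemma starZr (t : K) x : star (t%:C *: x) = t%:C *: star x.
Proof. by rewrite starZ; congr (_ *: _); exact: conjc_real. Qed.
Lemma smul_suml (I : Type) (s : seq I) (F : I -> V) x :
  (\sum_(i <- s) F i) ** x = \sum_(i <- s) F i ** x.
Proof.
by elim: s => [|i s IH]; rewrite ?big_nil ?smul0l // !big_cons smulDl IH.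
Qed.
Lemma smul_sumr (I : Type) (s : seq I) (F : I -> V) x :
  x ** (\sum_(i <- s) F i) = \sum_(i <- s) x ** F i.
Proof.
by elim: s => [|i s IH]; rewrite ?big_nil ?smul0r // !big_cons smulDr IH.
Qed.
Lemma star_sum (I : Type) (s : seq I) (F : I -> V) :
  star (\sum_(i <- s) F i) = \sum_(i <- s) star (F i).
Proof.
by elim: s => [|i s IH]; rewrite ?big_nil ?star0 // !big_cons starD IH.
Qed.

End StarAlgebra.

Section CStar2.
Variable A : cstarAlgType K.
Implicit Types x y : A.

Lemma rnorm_star x : rnorm (star x) = rnorm x.
Proof.
suff H z : rnorm z <= rnorm (star z :> A).
  by apply/eqP; rewrite eq_le H -{2}[x]starK H.
have [->|z0] := eqVneq (rnorm z) 0; first exact: rnorm_ge0.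
have zp : 0 < rnorm z by rewrite lt_neqAle eq_sym z0 rnorm_ge0.
by rewrite -(ler_pM2r zp) -expr2 -rnorm_cstar rnormM.
Qed.

End CStar2.

Section StarHom.
Variables (V W : starAlgType K) (f : V -> W).
Hypothesis fh : star_hom f.

Lemma star_homZ c x : f (c *: x) = c *: f x.
Proof.
have [fl _ _] := fh; have f0 : f 0 = 0.
  by apply: (addrI (f 0)); have := fl 1 0 0; rewrite !(scaler0, addr0, scale1r).
by have := fl c x 0; rewrite !addr0 f0 addr0.
Qed.
Lemma star_homD x y : f (x + y) = f x + f y.
Proof. by have [fl _ _] := fh; have := fl 1 x y; rewrite !scale1r. Qed.
Lemma star_hom0 : f 0 = 0.
Proof. by have := star_homZ 0 0; rewrite !scale0r. Qed.
Lemma star_homN x : f (- x) = - f x.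
Proof. by rewrite -scaleN1r star_homZ scaleN1r. Qed.
Lemma star_homB x y : f (x - y) = f x - f y.
Proof. by rewrite star_homD star_homN. Qed.
Lemma star_hom_sum (I : Type) (s : seq I) (F : I -> V) :
  f (\sum_(i <- s) F i) = \sum_(i <- s) f (F i).
Proof.
by elim: s => [|i s IH]; rewrite ?big_nil ?star_hom0 // !big_cons star_homD IH.
Qed.
Lemma star_homM x y : f (x ** y) = f x ** f y.
Proof. by have [_ fm _] := fh; exact: fm. Qed.
Lemma star_homS x : f (star x) = star (f x).
Proof. by have [_ _ fs] := fh; exact: fs. Qed.

End StarHom.

Lemma star_hom_comp (U V W : starAlgType K) (f : U -> V) (g : V -> W) :
  star_hom f -> star_hom g -> star_hom (g \o f).
Proof.
move=> fh gh; split=> [c x y|x y|x] /=.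
- by rewrite (star_homD fh) (star_homZ fh) (star_homD gh) (star_homZ gh).
- by rewrite (star_homM fh) (star_homM gh).
- by rewrite (star_homS fh) (star_homS gh).
Qed.

End Norm.

(** * Extension of densely defined *-homomorphisms *)

Section GraphClosure.
Variable K : realType.

(** Covers the norm of a C*-algebra and the l^1-norm of formal sums, whose
    carrier has no topology of its own. *)
Record submult_seminorm (V : starAlgType K) (N : V -> K) : Prop := {
  seminormD : forall x y, N (x + y) <= N x + N y;
  seminormZ : forall (c : K[i]) x, N (c *: x) <= complex.Re `|c| * N x;
  seminormM : forall x y, N (x ** y) <= N x * N y;
  seminorm_star : forall x, N (star x) <= N x
}.

Lemma rnorm_seminorm (A : cstarAlgType K) : submult_seminorm (@rnorm K A).
Proof.
split=> *; [exact: rnormD | by rewrite rnormZ | exact: rnormM |].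
by rewrite rnorm_star.
Qed.

Section Seminorm.
Variables (V : starAlgType K) (N : V -> K).
Hypothesis NS : submult_seminorm N.
Implicit Types v w : V.

Lemma seminorm0 : N 0 = 0.
Proof.
have N0 : N 0 <= 0.
  by have := seminormZ NS 0 0; rewrite scaler0 normr0 mul0r.
by have := seminormD NS 0 0; rewrite addr0; lra.
Qed.

Lemma seminormN v : N (- v) <= N v.
Proof.
by have := seminormZ NS (-1) v; rewrite scaleN1r normrN normr1 mul1r.
Qed.

Lemma seminorm_distC v w : N (v - w) = N (w - v).
Proof. by apply/eqP; rewrite eq_le -{1}opprB -{3}opprB !seminormN. Qed.

Lemma seminorm_ge0 v : 0 <= N v.
Proof.
have := seminormD NS v (- v); rewrite subrr seminorm0.
by have := seminormN v; lra.
Qed.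

Lemma seminorm_near v w : N v <= N w + N (v - w).
Proof. by have := seminormD NS w (v - w); rewrite addrC subrK. Qed.

Lemma seminormM_near v w v' w' (d : K) : d <= 1 ->
  N (v - v') <= d -> N (w - w') <= d ->
  N (v ** w - v' ** w') <= d * (N v + N w + 1).
Proof.
move=> d1 vd wd.
have -> : v ** w - v' ** w' = (v - v') ** w + v' ** (w - w').
  by rewrite smulBl smulBr addrA subrK.
have d0 : 0 <= d by apply: le_trans vd; exact: seminorm_ge0.
have := seminormD NS ((v - v') ** w) (v' ** (w - w')).
have := seminormM NS (v - v') w.
have := seminormM NS v' (w - w').
have h1 : N (v - v') * N w <= d * N w.
  by rewrite ler_wpM2r // seminorm_ge0.
have v'b : N v' <= N v + 1.
  by have := seminorm_near v' v; rewrite (seminorm_distC v'); lra.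
have h2 : N v' * N (w - w') <= (N v + 1) * d.
  by apply: ler_pM => //; exact: seminorm_ge0.
lra.
Qed.

End Seminorm.

(** A bounded densely defined *-homomorphism, given by its graph, extends to
    the whole algebra: the closure of the graph is again a *-subalgebra on
    which the bound holds, so it is the graph of a function, and completeness
    of the target makes this function total. *)
Lemma extend_graph (V : starAlgType K) (A : cstarAlgType K) (N : V -> K)
    (Gam : V -> A -> Prop) :
  submult_seminorm N ->
  (forall c v a w b, Gam v a -> Gam w b -> Gam (c *: v + w) (c *: a + b)) ->
  (forall v a w b, Gam v a -> Gam w b -> Gam (v ** w) (a ** b)) ->
  (forall v a, Gam v a -> Gam (star v) (star a)) ->
  (forall v a, Gam v a -> rnorm a <= N v) ->
  (forall v (e : K), 0 < e -> exists w a, Gam w a /\ N (v - w) <= e) ->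
  exists T : V -> A, [/\ star_hom T, forall v, rnorm (T v) <= N v
    & forall v a, Gam v a -> T v = a].
Proof.
move=> NS GL GM GS Gle Gd; have AS := rnorm_seminorm A.
pose cl v a := forall e : K, 0 < e -> exists w b,
  [/\ Gam w b, N (v - w) <= e & rnorm (a - b) <= e].
have cl_G v a : Gam v a -> cl v a.
  move=> va e /ltW e0; exists v, a; split=> //.
    by rewrite subrr (seminorm0 NS).
  by rewrite subrr rnorm0.
have clL c v a w b : cl v a -> cl w b -> cl (c *: v + w) (c *: a + b).
  move=> va wb e e0; pose k := complex.Re `|c|.
  have k0 : 0 <= k by exact: (@rnorm_ge0 K K[i]^o c).
  have d0 : 0 < e / (k + 1) by rewrite divr_gt0 // ltr_wpDl.
  have [v' [a' [va' vv aa]]] := va _ d0.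
  have [w' [b' [wb' ww bb]]] := wb _ d0.
  exists (c *: v' + w'), (c *: a' + b'); split; first exact: GL.
    have -> : c *: v + w - (c *: v' + w') = c *: (v - v') + (w - w').
      by rewrite scalerBr opprD addrACA.
    apply: le_trans (seminormD NS _ _) _.
    have -> : e = k * (e / (k + 1)) + e / (k + 1).
      by field; rewrite gt_eqF // ltr_wpDl.
    rewrite lerD //; apply: le_trans (seminormZ NS _ _) _.
    by rewrite ler_wpM2l.
  have -> : c *: a + b - (c *: a' + b') = c *: (a - a') + (b - b').
    by rewrite scalerBr opprD addrACA.
  apply: le_trans (rnormD _ _) _.
  have -> : e = k * (e / (k + 1)) + e / (k + 1).
    by field; rewrite gt_eqF // ltr_wpDl.
  by rewrite lerD // rnormZ ler_wpM2l.
have cl_le v a : cl v a -> rnorm a <= N v.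
  move=> va; apply/ler_addgt0Pr => e e0.
  have e20 : 0 < e / 2 by rewrite divr_gt0.
  have [w [b [wb vw ab]]] := va _ e20.
  have := seminorm_near AS a b; have := seminorm_near NS w v.
  by have := Gle _ _ wb; rewrite (seminorm_distC NS w); lra.
have cl_uniq v a b : cl v a -> cl v b -> a = b.
  move=> va vb; have := cl_le _ _ (clL (-1) _ _ _ _ va vb).
  rewrite !scaleN1r addNr (seminorm0 NS) => h.
  apply/esym/eqP; rewrite -subr_eq0 addrC; apply/eqP/rnorm_eq0/eqP.
  by rewrite eq_le h rnorm_ge0.
have clM v a w b : cl v a -> cl w b -> cl (v ** w) (a ** b).
  move=> va wb e e0.
  pose C := N v + N w + rnorm a + rnorm b + 1.
  have [v0 w0] := (seminorm_ge0 NS v, seminorm_ge0 NS w).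
  have [a0 b0] := (rnorm_ge0 a, rnorm_ge0 b).
  have C0 : 0 < C by rewrite /C; lra.
  pose d := Num.min 1 (e / C).
  have d0 : 0 < d by rewrite lt_min ltr01 divr_gt0.
  have d1 : d <= 1 by rewrite ge_min lexx.
  have dC : d * C <= e by rewrite -ler_pdivlMr // ge_min lexx orbT.
  have [v' [a' [va' vv aa]]] := va _ d0.
  have [w' [b' [wb' ww bb]]] := wb _ d0.
  exists (v' ** w'), (a' ** b'); split; first exact: GM.
    apply: le_trans (seminormM_near NS d1 vv ww) (le_trans _ dC).
    by rewrite ler_wpM2l ?(ltW d0) // /C; lra.
  apply: le_trans (seminormM_near AS d1 aa bb) (le_trans _ dC).
  by rewrite ler_wpM2l ?(ltW d0) // /C; lra.
have clS v a : cl v a -> cl (star v) (star a).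
  move=> va e e0; have [w [b [wb vw ab]]] := va _ e0.
  exists (star w), (star b); split; first exact: GS.
    by rewrite -starB (le_trans (seminorm_star NS _)).
  by rewrite -starB rnorm_star.
have cl_tot v : exists a, cl v a.
  have /choice[z zP] n : exists z : V * A,
      Gam z.1 z.2 /\ N (v - z.1) <= n.+1%:R^-1.
    by have [|w [a wa]] := Gd v n.+1%:R^-1; [rewrite invr_gt0 | exists (w, a)].
  have zD n m : rnorm ((z n).2 - (z m).2) <= n.+1%:R^-1 + m.+1%:R^-1.
    have [zn vn] := zP n; have [zm vm] := zP m.
    have := Gle _ _ (GL (-1) _ _ _ _ zm zn); rewrite !scaleN1r addrC => h.
    apply: le_trans h _; rewrite addrC.
    have -> : (z n).1 - (z m).1 = ((z n).1 - v) + (v - (z m).1).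
      by rewrite addrA subrK.
    apply: le_trans (seminormD NS _ _) _.
    by rewrite lerD // (seminorm_distC NS).
  have small (e : K) : 0 < e ->
      exists M, forall n, (M <= n)%N -> n.+1%:R^-1 < e.
    move=> e0; exists (Num.truncn e^-1) => n Mn.
    rewrite invf_plt ?posrE //; apply: lt_le_trans (truncnS_gt _) _.
    by rewrite ler_nat.
  have [|a aP] := @rnorm_complete K A (fun n => (z n).2).
    move=> e e0; have e20 : 0 < e / 2 by rewrite divr_gt0.
    have [M MP] := small _ e20; exists M => n m /MP n2 /MP m2.
    by apply: le_lt_trans (zD n m) _; rewrite (splitr e) ltrD.
  exists a => e e0; have [M MP] := small _ e0; have [M' MP'] := aP _ e0.
  pose n := maxn M M'; have [zn vn] := zP n.
  exists (z n).1, (z n).2; split=> //.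
    by apply: le_trans vn (ltW (MP _ _)); rewrite leq_maxl.
  by rewrite rnormB ltW // MP' // leq_maxr.
have [T TP] := choice cl_tot; exists T; split.
- split=> [c v w|v w|v]; apply: cl_uniq (TP _) _.
  + by apply: clL; exact: TP.
  + by apply: clM; exact: TP.
  + by apply: clS; exact: TP.
- by move=> v; exact: cl_le.
- by move=> v a va; apply: cl_uniq (TP v) (cl_G _ _ va).
Qed.

End GraphClosure.

(** * Automatic contractivity, and the norm of an orthogonal sum *)

Section Contractivity.
Variable K : realType.

Lemma geometric_small (r e : K) : 0 <= r < 1 -> 0 < e ->
  exists n, forall m, (n <= m)%N -> r ^+ m < e.
Proof.
move=> /andP[r0 r1] e0.
have /cvgrPdist_lt /(_ e e0)[N _ HN] : r ^+ x @[x --> \oo] --> 0.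
  by apply: cvg_expr; rewrite ger0_norm.
exists N => m Nm; have := HN _ Nm.
by rewrite /= sub0r normrN ger0_norm // exprn_ge0.
Qed.

Lemma eq_rnorm_eps (V : normedModType K[i]) (x y : V) :
  (forall e : K, 0 < e -> rnorm (x - y) <= e) -> x = y.
Proof.
move=> H; apply/eqP; rewrite -subr_eq0; apply/eqP/rnorm_eq0/eqP.
rewrite eq_le rnorm_ge0 andbT; apply/ler_addgt0Pr => e e0.
by rewrite add0r H.
Qed.

Lemma rnormZr (V : normedModType K[i]) (t : K) (x : V) :
  rnorm (t%:C *: x) = `|t| * rnorm x.
Proof.
rewrite rnormZ; congr (_ * _).
by rewrite normc_def /= expr0n addr0 sqrtr_sqr.
Qed.

Section Algebra.
Variable A : cstarAlgType K.
Implicit Types a b x y e : A.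

Definition selfadjoint a := star a = a.
Definition projection e := star e = e /\ e ** e = e.

Lemma rnorm_projection e : projection e -> rnorm e <= 1.
Proof.
case=> es ee; have := rnorm_cstar e; rewrite es ee expr2 => h.
have [->|n0] := eqVneq (rnorm e) 0; first exact: ler01.
have : rnorm e = 1 by apply: (mulfI n0); rewrite -h mulr1.
by move=> ->.
Qed.

Lemma half_half a : (2^-1%:C : K[i]) *: a + (2^-1%:C : K[i]) *: a = a.
Proof.
rewrite -scalerDl -rmorphD /=.
have -> : 2^-1 + 2^-1 = 1 :> K by field.
by rewrite rmorph1 scale1r.
Qed.

(** The element [h] plays the role of [1 - sqrt (1 - a^2)]. It is the fixed
    point of [h |-> (a^2 + h^2) / 2], a contraction of ratio [rnorm a] on the
    ball of radius [rnorm a]; being a limit of polynomials in [a], it is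
    self-adjoint and commutes with [a]. *)
Lemma one_minus_sqrt a : selfadjoint a -> rnorm a < 1 ->
  exists h, [/\ selfadjoint h, h ** a = a ** h
    & h + h = a ** a + h ** h].
Proof.
move=> sa a1; have a0 := rnorm_ge0 a; set r := rnorm a in a0 a1.
pose F h := (2^-1%:C : K[i]) *: (a ** a + h ** h).
pose s n := iter n F 0.
have rF x : rnorm x <= r -> rnorm (F x) <= r.
  move=> xr; rewrite /F rnormZr ger0_norm ?invr_ge0 ?ler0n //.
  have := rnormD (a ** a) (x ** x).
  have := rnormM a a; have := rnormM x x; rewrite -/r.
  by have := rnorm_ge0 x; nra.
have rs n : rnorm (s n) <= r.
  by elim: n => [|n IH]; [rewrite rnorm0 | exact: rF].
have FB x y : rnorm (F x - F y) <=
    (rnorm x + rnorm y) / 2 * rnorm (x - y).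
  have -> : F x - F y = (2^-1%:C : K[i]) *: (x ** (x - y) + (x - y) ** y).
    rewrite /F -scalerBr opprD addrACA subrr add0r.
    by rewrite smulBr smulBl addrA subrK.
  rewrite rnormZr ger0_norm ?invr_ge0 ?ler0n //.
  have := rnormD (x ** (x - y)) ((x - y) ** y).
  have := rnormM x (x - y); have := rnormM (x - y) y.
  by lra.
have sD n k : rnorm (s (n + k)%N - s n) <= r ^+ n.
  elim: n => [|n IH]; first by rewrite subr0 expr0 (le_trans (rs _)) // ltW.
  rewrite addSn [s _.+1]/= [s n.+1]/=; apply: le_trans (FB _ _) _.
  rewrite exprS; apply: ler_pM => //.
  - by rewrite divr_ge0 // addr_ge0 // rnorm_ge0.
  - exact: rnorm_ge0.
  by have := rs n; have := rs (n + k)%N; rewrite -/(s n) -/(s (n + k)); lra.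
have [|h hP] := @rnorm_complete K A s.
  move=> e e0; have e20 : 0 < e / 2 by rewrite divr_gt0.
  have [|N NP] := @geometric_small r (e / 2) _ e20; first by rewrite a0.
  exists N => n m Nn Nm; apply: le_lt_trans (rnorm_triangle (s N) _ _) _.
  rewrite (splitr e) ltrD //.
    by rewrite -(subnKC Nn); apply: le_lt_trans (sD _ _) (NP _ _).
  by rewrite rnormB -(subnKC Nm); apply: le_lt_trans (sD _ _) (NP _ _).
(* Identities satisfied along the iteration pass to the limit through maps
   that are Lipschitz at [h]. *)
have lim (P : A -> A) (c : K) : 0 < c ->
    (forall x (d : K), rnorm (x - h) <= d -> rnorm x <= r -> d <= 1 ->
      rnorm (P x - P h) <= c * d) ->
    forall e : K, 0 < e -> exists N, forall n, (N <= n)%N ->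
      rnorm (P (s n) - P h) <= e.
  move=> c0 H e e0; pose d := Num.min 1 (e / c).
  have d0 : 0 < d by rewrite lt_min ltr01 divr_gt0.
  have [N NP] := hP _ d0; exists N => n /NP /ltW nd.
  apply: le_trans (H _ _ nd (rs n) _) _; first by rewrite ge_min lexx.
  by rewrite mulrC -ler_pdivlMr // ge_min lexx orbT.
have sSa n : star (s n) = s n.
  elim: n => [|n IH]; first by rewrite star0.
  by rewrite /= /F starZr starD !starM sa IH.
have sCa n : s n ** a = a ** s n.
  elim: n => [|n IH]; first by rewrite smul0l smul0r.
  rewrite /= /F smulZl smulZr smulDl smulDr smulA; congr (_ *: (_ + _)).
  by rewrite -smulA IH !smulA IH.
have hr : rnorm h <= r.
  apply/ler_addgt0Pr => e e0; have [N /(_ N (leqnn _)) NP] := hP _ e0.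
  have := rnormD (s N) (h - s N); rewrite addrC subrK rnormB.
  by have := rs N; lra.
exists h; split.
- apply: eq_rnorm_eps => e e0.
  have [|N /(_ N (leqnn _))] := lim (fun x => star x - x) 2 (ltr0Sn K 1) _ _ e0.
    move=> x d xh _ _; have := rnormD (star (x - h)) (h - x).
    rewrite rnorm_star (rnormB h) starB.
    have -> : star x - star h + (h - x) = star x - x - (star h - h).
      by rewrite opprB addrACA [- star h + _]addrC [RHS]addrACA.
    by lra.
  by rewrite sSa subrr sub0r rnormN.
- apply: eq_rnorm_eps => e e0.
  have [|N /(_ N (leqnn _))] :=
    lim (fun x => x ** a - a ** x) 2 (ltr0Sn K 1) _ _ e0.
    move=> x d xh xr d1; have := rnormD ((x - h) ** a) (a ** (h - x)).
    have := rnormM (x - h) a; have := rnormM a (h - x).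
    rewrite (rnormB h) -/r smulBl smulBr.
    have -> : x ** a - h ** a + (a ** h - a ** x) =
        x ** a - a ** x - (h ** a - a ** h).
      by rewrite opprB addrACA [- (h ** a) + _]addrC [RHS]addrACA.
    by have := rnorm_ge0 (x - h); nra.
  by rewrite sCa subrr sub0r rnormN.
- suff hF : F h = h by rewrite -{1 2}hF half_half.
  apply: eq_rnorm_eps => e e0; have e20 : 0 < e / 2 by rewrite divr_gt0.
  have [|N NP] := lim F 1 ltr01 _ _ e20.
    move=> x d xh xr d1; apply: le_trans (FB _ _) _; apply: ler_pM => //.
    - by rewrite divr_ge0 // addr_ge0 // rnorm_ge0.
    - exact: rnorm_ge0.
    by lra.
  have [N' NP'] := hP _ e20; pose n := maxn N N'.
  apply: le_trans (rnorm_triangle (s n.+1) _ _) _.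
  rewrite (splitr e) lerD //; first by rewrite rnormB NP // leq_maxl.
  by rewrite ltW // NP' // (leq_trans (leq_maxr N N')).
Qed.

End Algebra.

Section Hom.
Variables (A C : cstarAlgType K) (one : A) (phi : A -> C).
Hypothesis oneP : forall x, one ** x = x /\ x ** one = x.
Hypothesis phiH : star_hom phi.

Let star_one : star one = one.
Proof.
have : star (star one ** one) = star one ** one by rewrite starM starK.
by rewrite (proj2 (oneP _)) starK.
Qed.

(** [a] is the average of the unitary [w = a + i sqrt (1 - a^2)] and its
    adjoint, and the image of a unitary has norm at most 1. *)
Lemma contractive_selfadjoint a : selfadjoint a -> rnorm a < 1 ->
  rnorm (phi a) <= 1.
Proof.
move=> sa /(one_minus_sqrt sa)[h [sh ha hE]].
pose w := a + 'i *: (one - h).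
have sw : star w = a - 'i *: (one - h).
  by rewrite /w starD starZ starB sa sh star_one conjCi scaleNr.
have ww : star w ** w = one.
  rewrite sw /w smulBl !smulDr !smulZl !smulZr scalerA -expr2 sqrCi scaleN1r.
  rewrite !smulBr !smulBl !(proj1 (oneP _)) !(proj2 (oneP _)) ha.
  rewrite opprD opprK addrA addrK.
  have -> : one - h - (h - h ** h) = one - (h + h) + h ** h.
    by rewrite opprB !opprD !addrA addrAC.
  by rewrite hE opprD !addrA [a ** a + one]addrC addrK subrK.
have p1 : projection (phi one).
  split; first by rewrite -(star_homS phiH) star_one.
  by rewrite -(star_homM phiH) (proj1 (oneP _)).
have w1 : rnorm (phi w) <= 1.
  rewrite -(@ler_sqr _ (rnorm (phi w)) 1) ?nnegrE ?rnorm_ge0 //.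
  rewrite -rnorm_cstar -(star_homS phiH) -(star_homM phiH) ww expr1n.
  exact: rnorm_projection.
have -> : phi a = (2^-1%:C : K[i]) *: (phi w + star (phi w)).
  rewrite -(star_homS phiH) -(star_homD phiH) sw /w addrACA subrr addr0.
  by rewrite -(star_homZ phiH) scalerDr half_half.
rewrite rnormZr ger0_norm ?invr_ge0 ?ler0n //.
have := rnormD (phi w) (star (phi w)); rewrite rnorm_star.
by lra.
Qed.

(** By scaling, the bound on the open unit ball holds for every self-adjoint
    element; the C*-identity applied to [star a ** a] reduces the general case
    to this one. *)
Lemma star_hom_contractive a : rnorm (phi a) <= rnorm a.
Proof.
have H b : selfadjoint b -> rnorm (phi b) <= rnorm b.
  move=> sb; apply/ler_addgt0Pr => e e0.
  have b0 := rnorm_ge0 b; set t := rnorm b + e.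
  have t0 : 0 < t by rewrite /t; lra.
  have ti : `|t^-1| = t^-1 by rewrite ger0_norm // invr_ge0 ltW.
  have := @contractive_selfadjoint (t^-1%:C *: b).
  rewrite /selfadjoint starZr sb (star_homZ phiH) !rnormZr ti ![t^-1 * _]mulrC.
  rewrite ltr_pdivrMr // ler_pdivrMr // !mul1r; apply=> //.
  by rewrite /t ltrDl.
rewrite -(@ler_sqr _ (rnorm (phi a)) (rnorm a)) ?nnegrE ?rnorm_ge0 //.
rewrite -!rnorm_cstar -(star_homS phiH) -(star_homM phiH) H //.
by rewrite /selfadjoint starM starK.
Qed.

End Hom.

Section Cut.
Variable A : cstarAlgType K.
Implicit Types a b x y e : A.

(* The powers of exponent [2 ^ n], for which the C*-identity computes the
   norm. *)
Let sq n b := iter n (fun x => x ** x) b.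

Let rnorm_sq n b : selfadjoint b ->
  selfadjoint (sq n b) /\ rnorm (sq n b) = rnorm b ^+ (2 ^ n).
Proof.
move=> sb; elim: n => [|n [IH1 IH2]]; first by rewrite expn0 expr1.
split; first by rewrite /selfadjoint /= starM IH1.
by rewrite /= -{1}IH1 rnorm_cstar IH2 -exprM expnSr.
Qed.

Let cut_selfadjoint e b : projection e -> selfadjoint b -> e ** b = b ** e ->
  rnorm b <= Num.max (rnorm (e ** b)) (rnorm (b - e ** b)).
Proof.
move=> [se ee] sb eb; set m := Num.max _ _; rewrite leNgt; apply/negP => mb.
have sE : selfadjoint (e ** b) by rewrite /selfadjoint starM sb se eb.
have sF : selfadjoint (b - e ** b) by rewrite /selfadjoint starB sb sE.
have sqC n : e ** sq n b = sq n b ** e.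
  by elim: n => [//|n IH] /=; rewrite smulA IH -smulA IH smulA.
have sqE n : sq n (e ** b) = e ** sq n b.
  elim: n => [//|n IH] /=; rewrite IH -smulA [_ ** (e ** _)]smulA -sqC.
  by rewrite -!smulA smulA ee.
have sqF n : sq n (b - e ** b) = sq n b - e ** sq n b.
  elim: n => [//|n IH] /=; rewrite IH smulBl !smulBr.
  have -> : e ** sq n b ** (e ** sq n b) = e ** (sq n b ** sq n b).
    by rewrite -smulA [_ ** (e ** _)]smulA -sqC -!smulA smulA ee.
  have -> : sq n b ** (e ** sq n b) = e ** (sq n b ** sq n b).
    by rewrite smulA -sqC smulA.
  by rewrite -smulA subrr subr0.
have m0 : 0 <= m by rewrite le_max rnorm_ge0.
have b0 : 0 < rnorm b by apply: le_lt_trans mb.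
have mb1 : 0 <= m / rnorm b < 1.
  by rewrite divr_ge0 ?rnorm_ge0 //= ltr_pdivrMr // mul1r.
have h2 : 0 < 2^-1 :> K by rewrite invr_gt0 ltr0n.
have [N NP] := geometric_small mb1 h2.
have := NP (2 ^ N)%N (ltnW (ltn_expl N (ltnSn 1))).
rewrite expr_div_n ltr_pdivrMr ?exprn_gt0 //.
have [_ nb] := rnorm_sq N sb; have [_ nE] := rnorm_sq N sE.
have [_ nF] := rnorm_sq N sF; rewrite -nb.
have := rnormD (e ** sq N b) (sq N b - e ** sq N b).
rewrite addrC subrK -sqF -sqE nE nF.
have : rnorm (e ** b) ^+ (2 ^ N) <= m ^+ (2 ^ N).
  by rewrite lerXn2r ?nnegrE ?rnorm_ge0 // le_max lexx.
have : rnorm (b - e ** b) ^+ (2 ^ N) <= m ^+ (2 ^ N).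
  by rewrite lerXn2r ?nnegrE ?rnorm_ge0 // le_max lexx orbT.
lra.
Qed.

(** In the commutative picture the norm is a supremum, attained on one of the
    two complementary pieces cut out by [e]. For self-adjoint [b], the triangle
    inequality applied to the power [2 ^ n] of [b] bounds [rnorm b] by the
    maximum of the two norms up to the factor [2 ^ (1 / 2 ^ n)], which tends
    to 1. *)
Lemma rnorm_cut e y : projection e -> e ** y = y ** e ->
  rnorm y <= rnorm (e ** y) \/ rnorm y <= rnorm (y - e ** y).
Proof.
move=> pe ey; have [se ee] := pe.
have eys : e ** star y = star y ** e by rewrite -{1}se -starM -ey starM se.
have sb : selfadjoint (star y ** y) by rewrite /selfadjoint starM starK.
have eb : e ** (star y ** y) = star y ** y ** e.
  by rewrite smulA eys -smulA ey smulA.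
have E1 : star (e ** y) ** (e ** y) = e ** (star y ** y).
  by rewrite starM se -smulA [e ** (e ** _)]smulA ee smulA -eys smulA.
have E2 : star (y - e ** y) ** (y - e ** y) = star y ** y - e ** (star y ** y).
  rewrite starB smulBl !smulBr E1 starM se [star y ** (e ** y)]smulA -eys.
  by rewrite -smulA subrr subr0.
have := cut_selfadjoint pe sb eb; rewrite -E2 -E1 !rnorm_cstar le_max.
by rewrite !ler_sqr ?nnegrE ?rnorm_ge0 // => /orP.
Qed.

End Cut.

End Contractivity.

(** * Words in the generators *)

Section Words.
Variables (K : realType) (G : groupType) (J : Type).

Definition move_symb (t : G) (x : symb G J) : symb G J := ((t * x.1)%g, x.2).

(** [((c, w), g)] stands for [c * \prod_(x <- w) 1_x * 1_g delta_g] on the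
    side of the crossed product, and for [c] times the product of the
    projections listed by [w] times the generator of [g] on the side of the
    relations. Both satisfy the multiplication and adjoint rules that follow. *)
Definition monomial : Type := K[i] * seq (symb G J) * G.

Definition mono_mul (m m' : monomial) : monomial :=
  (m.1.1 * m'.1.1,
   m.1.2 ++ (m.2, None) :: map (move_symb m.2) m'.1.2,
   (m.2 * m'.2)%g).

Definition mono_star (m : monomial) : monomial :=
  ((m.1.1)^*, map (move_symb m.2^-1) m.1.2, m.2^-1%g).

Section Relations.
Variables (A : cstarAlgType K) (u : G -> A) (P : J -> A).
Hypothesis rel : pr_relations u P.

Let e := symb_elt u P.

Lemma gen1l x : u 1%g ** x = x. Proof. by case: (pr_unit rel x). Qed.
Lemma gen1r x : x ** u 1%g = x. Proof. by case: (pr_unit rel x). Qed.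

Lemma star_gen r : star (u r) = u r^-1%g. Proof. by rewrite (pr_inv rel). Qed.

(** The adjoint of the relation [[r][s][s^-1] = [rs][s^-1]]. *)
Lemma gen_genV_gen s t : u s ** u s^-1%g ** u t = u s ** u (s^-1 * t)%g.
Proof.
have := congr1 star (pr_mul rel t^-1%g s).
by rewrite !starM !star_gen !invgM !invgK smulA.
Qed.

Lemma gen_partial_isometry s : u s ** u s^-1%g ** u s = u s.
Proof. by rewrite gen_genV_gen mulVg gen1r. Qed.

Lemma symbE0 r : e (r, None) = u r ** u r^-1%g.
Proof. by rewrite /e /symb_elt /= star_gen. Qed.

Lemma symbE1 r i : e (r, Some i) = u r ** P i ** u r^-1%g.
Proof. by rewrite /e /symb_elt /= star_gen. Qed.

Lemma symb1 i : e (1%g, Some i) = P i.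
Proof. by rewrite symbE1 invg1 gen1l gen1r. Qed.

Lemma gen_symb0 r s : u r ** e (s, None) = e ((r * s)%g, None) ** u r.
Proof.
by rewrite !symbE0 smulA (pr_mul rel) gen_genV_gen invgM -mulgA mulVg mulg1.
Qed.

Lemma gen_mul g h : u g ** u h = e (g, None) ** u (g * h)%g.
Proof. by rewrite symbE0 gen_genV_gen mulKg. Qed.

Lemma symb_comm x y : e x ** e y = e y ** e x.
Proof.
have H r s : e (r, None) ** e (s, None) = e (s, None) ** e (r, None).
  rewrite {1}symbE0 -smulA gen_symb0 smulA gen_symb0 mulVKg.
  by rewrite -smulA -symbE0.
case: x y => [r [i|]] [s [j|]] //.
- exact: (pr_comm rel).
- exact/esym/(pr_comm0 rel).
- exact: (pr_comm0 rel).
Qed.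

Lemma gen_symbV r : u r ** e (r^-1%g, None) = u r.
Proof. by rewrite symbE0 invgK smulA gen_partial_isometry. Qed.

Lemma symb_genV r : e (r^-1%g, None) ** u r^-1%g = u r^-1%g.
Proof. by rewrite symbE0 gen_partial_isometry. Qed.

Lemma symb_projection x : projection (e x).
Proof.
case: x => r [i|]; last first.
  split; rewrite symbE0; first by rewrite starM !star_gen invgK.
  by rewrite smulA gen_partial_isometry.
have [Ps Pp] := pr_proj rel i.
split; first by rewrite symbE1 !starM !star_gen Ps invgK smulA.
have Pc : P i ** e (r^-1%g, None) = e (r^-1%g, None) ** P i.
  by rewrite -symb1 symb_comm.
rewrite symbE1 -!smulA [u r^-1%g ** _]smulA.
have -> : u r^-1%g ** u r = e (r^-1%g, None) by rewrite symbE0 invgK.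
rewrite [e _ ** _]smulA -Pc -smulA [P i ** (P i ** _)]smulA -Pp.
by rewrite symb_genV.
Qed.

Lemma symb_le r i : e (r, Some i) ** e (r, None) = e (r, Some i).
Proof.
rewrite symbE1 symbE0 -!smulA [u r^-1%g ** _]smulA.
by have := gen_partial_isometry r^-1%g; rewrite invgK => ->.
Qed.

(** Conjugation by a generator realizes the partial action on symbols: first
    [[g] e_x [g]^* = e_g e_(gx)], where [e_g = [g][g]^*], and then [[g]^*[g]]
    commutes with [e_x]. *)
Lemma gen_symb g x : u g ** e x = e (move_symb g x) ** u g.
Proof.
case: x => r [i|]; last exact: gen_symb0.
have E1 : u g ** u r = e (g, None) ** u (g * r)%g by exact: gen_mul.
have E2 : u r^-1%g ** u g^-1%g = u (g * r)^-1%g ** e (g, None).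
  rewrite -(star_gen r) -(star_gen g) -starM E1 starM star_gen.
  by case: (symb_projection (g, None)) => ->.
have E3 : u g ** e (r, Some i) ** u g^-1%g =
    e (g, None) ** e ((g * r)%g, Some i).
  have -> : u g ** e (r, Some i) ** u g^-1%g =
      (u g ** u r) ** P i ** (u r^-1%g ** u g^-1%g) by rewrite symbE1 !smulA.
  have [_ <-] := symb_projection (g, None).
  rewrite -[RHS]smulA (symb_comm (g, None)) [RHS]smulA E1 E2 symbE1.
  by rewrite !smulA.
rewrite -{1}(gen_symbV g) -smulA symb_comm [e (g^-1%g, _)]symbE0 invgK.
rewrite smulA [_ ** (u _ ** u _)]smulA E3 symb_comm -smulA.
by rewrite [e (g, _)]symbE0 gen_partial_isometry.
Qed.

Definition word_elt (w : seq (symb G J)) : A :=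
  foldr (fun x y => e x ** y) (u 1%g) w.

Lemma word_cat w w' : word_elt (w ++ w') = word_elt w ** word_elt w'.
Proof. by elim: w => [|x w IH] /=; rewrite ?gen1l // IH smulA. Qed.

Lemma symb_word x w : e x ** word_elt w = word_elt w ** e x.
Proof.
elim: w => [|y w IH] /=; first by rewrite gen1l gen1r.
by rewrite smulA symb_comm -!smulA IH.
Qed.

Lemma star_word w : star (word_elt w) = word_elt w.
Proof.
elim: w => [|y w IH] /=; first by rewrite star_gen invg1.
by have [se _] := symb_projection y; rewrite starM IH se symb_word.
Qed.

Lemma gen_word g w : u g ** word_elt w = word_elt (map (move_symb g) w) ** u g.
Proof.
elim: w => [|x w IH] /=; first by rewrite gen1l gen1r.
by rewrite smulA gen_symb -!smulA IH.
Qed.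

Definition mono_elt (m : monomial) : A := m.1.1 *: (word_elt m.1.2 ** u m.2).

Lemma mono_elt_mul m m' : mono_elt (mono_mul m m') = mono_elt m ** mono_elt m'.
Proof.
rewrite /mono_elt /= smulZl smulZr scalerA; congr (_ *: _).
rewrite word_cat -smulA -[RHS]smulA; congr (_ ** _); rewrite [LHS]/=.
by rewrite -/e symb_word -smulA -gen_mul [LHS]smulA -gen_word smulA.
Qed.

Lemma mono_elt_star m : mono_elt (mono_star m) = star (mono_elt m).
Proof. by rewrite /mono_elt /= starZ starM star_word star_gen gen_word. Qed.

Lemma expr_eltE p : expr_elt u P p = \sum_(m <- p) m.1 *: word_elt m.2.
Proof. by []. Qed.

End Relations.
End Words.

(** * Compactness of the cube and locally constant functions *)

Section Cylinders.
Variables (K : realType) (G : groupType) (J : Type).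

Notation csymb := {classic symb G J}.
Implicit Types (xi eta : subsets G J) (F : seq csymb).

Definition cylinder F xi : set (subsets G J) :=
  [set eta | forall x, x \in F -> eta x = xi x].

Definition restriction F xi : seq (csymb * bool) := [seq (x, xi x) | x <- F].

Lemma mem_restriction F xi x : x \in F -> (x, xi x) \in restriction F xi.
Proof. exact: (@map_f csymb _ (fun y => (y, xi y))). Qed.

Lemma nbhs_cylinder F xi : nbhs xi (cylinder F xi).
Proof.
elim: F => [|x F IH]; first by apply: filterS filterT => eta _ x.
apply: filterS2 IH (near_coord (x : symb G J) xi) => eta IH etax y.
by rewrite inE => /predU1P[->|/IH].
Qed.

Lemma cylinder_basis xi (U : set (subsets G J)) : nbhs xi U ->
  exists F, cylinder F xi `<=` U.
Proof.
pose cyl := filter_from setT (fun F => cylinder F xi).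
have cylF : Filter cyl.
  apply: filter_from_filter; first by exists [::].
  move=> F F' _ _; exists (F ++ F') => // eta etaF.
  by split=> x xF; apply: etaF; rewrite mem_cat xF ?orbT.
have : cyl --> xi.
  apply/cvg_sup => x V /= [W [[C oC <-] Cx] WV].
  exists [:: (x : csymb)] => // eta etax; apply: WV => /=.
  by rewrite etax // mem_head.
by move=> /[apply] -[F _ FU]; exists F.
Qed.

(** Compactness of the cube, in the form of a choice of one bit after the
    other. The sets of points whose restriction to a given finite [F] satisfies
    [Q] form a filter base; any cluster point works, since membership in such a
    set depends on finitely many coordinates. *)
Lemma compact_choice (Q : seq (csymb * bool) -> Prop) :
  Q [::] ->
  (forall l x, Q l -> exists b, Q ((x, b) :: l)) ->
  (forall l l', {subset l' <= l} -> Q l -> Q l') ->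
  (forall l x, (x, true) \in l -> (x, false) \in l -> ~ Q l) ->
  exists xi, forall F, Q (restriction F xi).
Proof.
move=> Q0 Qs Qm Qc.
have fin F : exists xi, Q (restriction F xi).
  elim: F => [|x F [xi IH]]; first by exists (fun=> true).
  have [b Qb] := Qs _ x IH.
  pose xi' : subsets G J := fun y => if (y : csymb) == x then b else xi y.
  exists xi'; rewrite /restriction /= {1}/xi' eqxx.
  suff -> : [seq (y, xi' y) | y <- F] = restriction F xi by [].
  rewrite /restriction; apply/(@eq_in_map csymb) => y yF; rewrite /xi'.
  case: eqP => // yx; congr (_, _).
  have xF : (x, xi x) \in (x, b) :: restriction F xi.
    by rewrite inE mem_restriction ?orbT // -yx.
  have bF : (x, b) \in (x, b) :: restriction F xi by rewrite mem_head.
  rewrite yx; case bE : b xF bF Qb; case xE : (xi x) => // xF bF Qb; exfalso.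
    exact: Qc bF xF Qb.
  exact: Qc xF bF Qb.
pose B F : set (subsets G J) := [set xi | Q (restriction F xi)].
have BF : ProperFilter (filter_from setT B).
  apply: filter_from_proper; last by move=> F _; exact: fin.
  apply: filter_from_filter; first by exists [::].
  move=> F F' _ _; exists (F ++ F') => // xi; rewrite /B /restriction /=.
  by rewrite map_cat => Qx; split; apply: Qm Qx => z zF;
    rewrite mem_cat zF ?orbT.
have cpt : compact [set: subsets G J].
  have := @tychonoff csymb (fun=> bool) (fun=> setT) (fun=> bool_compact).
  by congr compact; apply/seteqP; split.
have [|xi [_ xiB]] := cpt _ BF; first exact: filterT.
exists xi => F.
have [|eta [/= etaB etaF]] := xiB (B F) _ _ (nbhs_cylinder F xi).
  by exists F.
suff -> : restriction F xi = restriction F eta by [].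
by rewrite /restriction; apply/(@eq_in_map csymb) => x xF; rewrite etaF.
Qed.

Definition expr_move (t : G) (p : expr K G J) : expr K G J :=
  [seq (m.1, map (move_symb t) m.2) | m <- p].

Lemma expr_fun_move t p xi :
  expr_fun (expr_move t p) xi = expr_fun p (Defs.shift t^-1%g xi).
Proof.
rewrite /expr_fun /expr_move big_map; apply: eq_bigr => m _ /=.
rewrite big_map; congr (_ * _); apply: eq_bigr => x _.
by rewrite /char_fun /Defs.shift invgK.
Qed.

Lemma expr_fun_cat (p q : expr K G J) xi :
  expr_fun (p ++ q) xi = expr_fun p xi + expr_fun q xi.
Proof. by rewrite /expr_fun big_cat. Qed.

Definition expr_symbols (p : expr K G J) : seq csymb :=
  flatten [seq m.2 : seq csymb | m <- p].

Lemma expr_fun_local p xi eta : cylinder (expr_symbols p) xi eta ->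
  expr_fun p eta = expr_fun p xi.
Proof.
elim: p => [|m p IH] h; first by rewrite /expr_fun !big_nil.
rewrite -cat1s !expr_fun_cat IH; last first.
  by move=> x xp; apply: h; rewrite /expr_symbols /= mem_cat xp orbT.
congr (_ + _); rewrite /expr_fun !big_seq1; congr (_ * _).
have {}h x : x \in (m.2 : seq csymb) -> eta x = xi x.
  by move=> xm; apply: h; rewrite /expr_symbols /= mem_cat xm.
elim: (m.2 : seq csymb) h => [|x w IHw] h; first by rewrite !big_nil.
rewrite !big_cons /char_fun h ?mem_head // IHw // => y yw.
by rewrite h // inE yw orbT.
Qed.

Variable R : set (subsets G J -> K[i]).
Hypothesis R_expr : forall f, R f -> exists p : expr K G J, represents p f.

(** Each condition defining Omega involves finitely many coordinates, because
    the relations are given by expressions. *)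
Lemma Omega_closed xi :
  (forall F, exists2 eta, Omega R eta & cylinder F xi eta) -> Omega R xi.
Proof.
move=> H.
have XGxi : XG xi.
  split=> [|r i xir].
    have [eta [[eta1 _] _] etaF] := H [:: (1%g, None) : csymb].
    by rewrite -etaF // mem_head.
  have [eta [[_ etaX] _] etaF] := H [:: (r, Some i) : csymb; (r, None)].
  rewrite -etaF ?inE ?eqxx ?orbT //; apply: (etaX _ i).
  by rewrite etaF ?inE ?eqxx.
split=> // t xit f Rf; have [p pf] := R_expr Rf.
have [eta [etaX etaR] etaF] :=
  H ((t, None) :: expr_symbols (expr_move t p)).
have etat : eta (t, None) by rewrite etaF ?mem_head.
have sX zeta : XG zeta -> zeta (t, None) -> XG (Defs.shift t^-1%g zeta).
  move=> [z1 zX] zt; split=> [|r i]; rewrite /Defs.shift /= invgK ?mulg1 //.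
  exact: zX.
rewrite pf; last exact: sX.
rewrite -expr_fun_move -(@expr_fun_local _ _ eta); last first.
  by move=> x xp; apply: etaF; rewrite inE xp orbT.
rewrite expr_fun_move -pf; last exact: sX.
exact: etaR.
Qed.

(** If [f] had no approximation on Omega, then some choice of all the bits
    would leave it without approximation on every cylinder around a single
    point; but near a point of Omega a constant does the job, and away from
    Omega there is nothing to approximate. *)
Lemma expr_fun_dense (f : subsets G J -> K[i]) (eps : K) :
  {within Omega R, continuous (f : subsets G J -> K[i]^o)} -> 0 < eps ->
  exists p : expr K G J, forall xi, Omega R xi ->
    rnorm (f xi - expr_fun p xi : K[i]^o) <= eps.
Proof.
move=> /subspace_continuousP fC eps0.
pose good (l : seq (csymb * bool)) := exists p : expr K G J,
  forall xi, Omega R xi -> (forall z, z \in l -> xi z.1 = z.2) ->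
    rnorm (f xi - expr_fun p xi : K[i]^o) <= eps.
suff [p pP] : good [::] by exists p => xi Oxi; exact: pP.
apply: contrapT => bad0.
have [||||xi xiP] := @compact_choice (fun l => ~ good l).
- exact: bad0.
- move=> l x bl; apply: contrapT => /forallNP H; apply: bl.
  have /contrapT[p pP] := H true; have /contrapT[q qP] := H false.
  (* Glue along the clopen set of [x]: 1_x p + q - 1_x q. *)
  pose px := [seq (m.1, (x : symb G J) :: m.2) | m <- p].
  pose qx := [seq (- m.1, (x : symb G J) :: m.2) | m <- q].
  exists (px ++ q ++ qx) => xi Oxi xil.
  have pxE : expr_fun px xi = char_fun K x xi * expr_fun p xi.
    rewrite /expr_fun big_map mulr_sumr; apply: eq_bigr => m _.
    by rewrite big_cons mulrCA.
  have qxE : expr_fun qx xi = - (char_fun K x xi * expr_fun q xi).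
    rewrite /expr_fun big_map mulr_sumr -sumrN; apply: eq_bigr => m _.
    by rewrite big_cons mulrCA mulNr mulrN.
  rewrite !expr_fun_cat pxE qxE /char_fun; case xix : (xi x).
    rewrite mul1r mul1r subrr addr0; apply: pP => // z.
    by rewrite inE => /predU1P[->|/xil].
  rewrite !mul0r oppr0 addr0 add0r; apply: qP => // z.
  by rewrite inE => /predU1P[->|/xil].
- move=> l l' ll' bl [p pP]; apply: bl; exists p => xi Oxi xil.
  by apply: pP => // z /ll'; exact: xil.
- move=> l x xt xf; apply; exists [::] => xi _ xil.
  by have := xil _ xt; rewrite /= (xil _ xf).
have Oxi : Omega R xi.
  apply: Omega_closed => F; apply: contrapT => nF; apply: (xiP F).
  exists [::] => eta Oeta etaF; exfalso; apply: nF; exists eta => // x xF.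
  by apply: (etaF (x, xi x)); exact: mem_restriction.
have eC : 0 < eps%:C by rewrite ltcR.
have /cvgrPdist_le /(_ _ eC) := fC _ Oxi.
move=> /cylinder_basis[F FP]; apply: (xiP F).
exists [:: (f xi, [::])] => eta Oeta etaF.
rewrite /expr_fun big_seq1 /= big_nil mulr1 rnormB -lecR -normc_rnorm.
apply: FP => // x xF.
by apply: (etaF (x, xi x)); exact: mem_restriction.
Qed.

End Cylinders.

(** * The relations only see the values on Omega *)

Section Spectrum.
Variables (K : realType) (G : groupType) (J : Type).
Variables (A : cstarAlgType K) (u : G -> A) (P : J -> A).
Hypothesis rel : pr_relations u P.

Notation csymb := {classic symb G J}.
Let e := symb_elt u P.
Let gen1l := gen1l rel.
Let gen1r := gen1r rel.
Let symb_comm := symb_comm rel.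
Implicit Types (c : csymb * bool) (l : seq (csymb * bool)).

Definition atom_factor c : A :=
  if c.2 then symb_elt u P c.1 else u 1%g - symb_elt u P c.1.

(** The projection corresponding to the characteristic function of the
    cylinder defined by the constraints [l]. *)
Definition atom l : A := foldr (fun c y => atom_factor c ** y) (u 1%g) l.

Let comm_atom_factor y : (forall x, e x ** y = y ** e x) ->
  forall c, atom_factor c ** y = y ** atom_factor c.
Proof.
move=> ey [x []]; rewrite /atom_factor /=; first exact: ey.
by rewrite smulBl smulBr gen1l gen1r ey.
Qed.

Let symb_atom_factor x c : e x ** atom_factor c = atom_factor c ** e x.
Proof. by rewrite comm_atom_factor. Qed.

Let atom_factorC c c' :
  atom_factor c ** atom_factor c' = atom_factor c' ** atom_factor c.
Proof. by rewrite (comm_atom_factor (y := atom_factor c')). Qed.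

Let comm_atom y : (forall x, e x ** y = y ** e x) ->
  forall l, y ** atom l = atom l ** y.
Proof.
move=> ey; elim=> [|c l IH] /=; first by rewrite gen1l gen1r.
by rewrite smulA -comm_atom_factor // -!smulA IH.
Qed.

Let atom_factor_atom c l : atom_factor c ** atom l = atom l ** atom_factor c.
Proof. by apply: comm_atom => x; exact: symb_atom_factor. Qed.

Let atom_factor_projection c : projection (atom_factor c).
Proof.
case: c => x b; have [se ee] := symb_projection rel x.
rewrite /atom_factor /=; case: b => //; split.
  by rewrite starB se (star_gen rel) invg1.
by rewrite smulBl gen1l smulBr gen1r ee subrr subr0.
Qed.

Let atom_factor_disjoint x :
  atom_factor (x, true) ** atom_factor (x, false) = 0.
Proof.
have [_ ee] := symb_projection rel x.
by rewrite /atom_factor /= smulBr gen1r ee subrr.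
Qed.

Let atom_mem c l : c \in l -> atom l ** atom_factor c = atom l.
Proof.
rewrite -atom_factor_atom; elim: l => [//|c' l IH]; rewrite inE.
case/predU1P => [<-|/IH {}IH] /=.
  by have [_ ee] := atom_factor_projection c; rewrite smulA ee.
by rewrite smulA atom_factorC -smulA IH.
Qed.

Let atom_sub l l' : {subset l' <= l} -> atom l ** atom l' = atom l.
Proof.
elim: l' => [|c l' IH] ll'; first by rewrite gen1r.
rewrite /= smulA atom_mem ?ll' ?mem_head // IH // => z zl'.
by rewrite ll' // inE zl' orbT.
Qed.

Let atom_inconsistent l x : (x, true) \in l -> (x, false) \in l -> atom l = 0.
Proof.
move=> /atom_mem <- /atom_mem <-.
by rewrite -smulA atom_factorC atom_factor_disjoint smul0r.
Qed.

Let rnorm_atom l : rnorm (atom l) <= 1.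
Proof.
elim: l => [|c l IH] /=.
  by apply: rnorm_projection; split; rewrite ?gen1l // (star_gen rel) invg1.
apply: le_trans (rnormM _ _) _; apply: mulr_ile1 => //; try exact: rnorm_ge0.
exact: rnorm_projection.
Qed.

Section Evaluation.
Variables (xi : subsets G J) (l : seq (csymb * bool)).

Lemma atom_symb (x : csymb) : (x, xi x) \in l ->
  atom l ** symb_elt u P x = char_fun K x xi *: atom l.
Proof.
rewrite /char_fun => xl; have := atom_mem xl; case: (xi x) => h.
  by rewrite scale1r.
rewrite scale0r -h -smulA.
by rewrite -[symb_elt u P x]/(atom_factor (x, true)) atom_factorC
           atom_factor_disjoint smul0r.
Qed.

Lemma atom_word (w : seq csymb) : (forall x, x \in w -> (x, xi x) \in l) ->
  atom l ** word_elt u P w = (\prod_(x <- w) char_fun K x xi) *: atom l.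
Proof.
elim: w => [|x w IH] wl; first by rewrite big_nil scale1r /= gen1r.
rewrite big_cons /= smulA atom_symb ?wl ?mem_head // smulZl IH ?scalerA //.
by move=> y yw; rewrite wl // inE yw orbT.
Qed.

(** The projection of a symbol constrained by [l] is either above the atom or
    orthogonal to it. *)
Lemma atom_expr (p : expr K G J) :
  (forall x, x \in expr_symbols p -> (x, xi x) \in l) ->
  atom l ** expr_elt u P p = expr_fun p xi *: atom l.
Proof.
elim: p => [|m p IH] pl.
  by rewrite /expr_elt /expr_fun !big_nil smul0r scale0r.
rewrite expr_eltE big_cons smulDr -expr_eltE IH; last first.
  by move=> x xp; apply: pl; rewrite /expr_symbols /= mem_cat xp orbT.
rewrite smulZr atom_word => [|x xm]; last first.
  by apply: pl; rewrite /expr_symbols /= mem_cat xm.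
by rewrite scalerA -scalerDl /expr_fun big_cons.
Qed.

End Evaluation.

Variable R : set (subsets G J -> K[i]).
Hypothesis R_expr : forall f, R f -> exists p : expr K G J, represents p f.
Hypothesis relR : forall f p, R f -> represents p f -> expr_elt u P p = 0.

(** Whenever [xi] violates one of the conditions that define Omega, the
    corresponding relation kills an atom around [xi]. For a relation [f]
    translated by [t], this relation is the conjugate by [u t] of the vanishing
    of the element given by [f]. *)
Lemma atoms_Omega xi :
  (forall F, atom (restriction F xi) != 0) -> Omega R xi.
Proof.
move=> xiP.
have xr F (x : csymb) : x \in F -> (x, xi x) \in restriction F xi.
  exact: mem_restriction.
have XGxi : XG xi.
  split=> [|r i xir]; apply/negP => /negP nxi.
    have := xiP [:: (1%g, None) : csymb]; rewrite /restriction /= (negbTE nxi).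
    by rewrite /atom_factor /= (symbE0 rel) invg1 gen1r gen1l subrr eqxx.
  have := xiP [:: (r, Some i) : csymb; (r, None)].
  rewrite /restriction /= xir (negbTE nxi) /atom_factor /= !gen1r smulBr gen1r.
  by rewrite (symb_le rel) subrr eqxx.
split=> // t xit f Rf; have [p pf] := R_expr Rf.
have Xs : XG (Defs.shift t^-1%g xi).
  case: XGxi => [xi1 xiX].
  by split=> [|r i]; rewrite /Defs.shift /= invgK ?mulg1 //; exact: xiX.
rewrite pf // -expr_fun_move.
pose F := ((t, None) : csymb) :: expr_symbols (expr_move t p).
have p0 : symb_elt u P (t, None) ** expr_elt u P (expr_move t p) = 0.
  have up : u t ** expr_elt u P p ** u t^-1%g = 0.
    by rewrite (relR Rf pf) smul0r smul0l.
  rewrite -[RHS]up !expr_eltE big_map !smul_sumr smul_suml.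
  apply: eq_bigr => m _; rewrite !smulZr smulZl; congr (_ *: _).
  by rewrite (gen_word rel) -smulA -(symbE0 rel) (symb_word rel).
have := congr1 (fun y => atom (restriction F xi) ** y) p0.
rewrite smul0r smulA (@atom_symb xi); last by rewrite xr // mem_head.
rewrite /char_fun xit scale1r (@atom_expr xi); last first.
  by move=> x xp; rewrite xr // inE xp orbT.
by move=> /eqP; rewrite scaler_eq0 (negbTE (xiP F)) orbF => /eqP.
Qed.

(** Cutting [y = expr_elt u P p] by one projection after the other without
    losing norm singles out a point [xi] all of whose atoms are nonzero, so
    [xi] is in Omega; and on a small enough atom [y] acts as the scalar
    [expr_fun p xi]. In particular [y] depends only on the restriction of the
    function of [p] to Omega, and contractively so. *)
Lemma rnorm_expr p : expr_elt u P p != 0 ->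
  exists2 xi, Omega R xi &
    rnorm (expr_elt u P p) <= rnorm (expr_fun p xi : K[i]^o).
Proof.
move=> y0; set y := expr_elt u P p in y0 *.
have yp : 0 < rnorm y.
  rewrite lt_neqAle rnorm_ge0 andbT eq_sym.
  by apply: contra_neq y0; exact: rnorm_eq0.
have ey x : e x ** y = y ** e x.
  rewrite /y expr_eltE smul_sumr smul_suml; apply: eq_bigr => m _.
  by rewrite smulZr smulZl (symb_word rel).
have [||||xi xiP] :=
  @compact_choice G J (fun l => rnorm y <= rnorm (atom l ** y)).
- by rewrite /= gen1l.
- move=> l x yl.
  have ec : e x ** (atom l ** y) = atom l ** y ** e x.
    by rewrite smulA (comm_atom (fun z => symb_comm z x)) -[LHS]smulA ey smulA.
  have [h|h] := rnorm_cut (symb_projection rel x) ec.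
  + by exists true; rewrite /= -smulA; apply: le_trans yl h.
  + exists false; rewrite /= -smulA; apply: le_trans yl (le_trans h _).
    by rewrite /atom_factor /= smulBl gen1l.
- move=> l l' ll' yl; apply: le_trans yl _.
  rewrite -(atom_sub ll') -smulA; apply: le_trans (rnormM _ _) _.
  by rewrite -[leRHS]mul1r ler_wpM2r // rnorm_ge0.
- move=> l x xt xf; rewrite (atom_inconsistent xt xf) smul0l rnorm0.
  by rewrite leNgt yp.
exists xi.
  apply: atoms_Omega => F; apply/eqP => F0; have := xiP F.
  by rewrite F0 smul0l rnorm0 leNgt yp.
apply: le_trans (xiP (expr_symbols p)) _.
rewrite /y (@atom_expr xi) => [|x xp]; last exact: mem_restriction.
rewrite rnormZ -[leRHS]mulr1; apply: ler_wpM2l (rnorm_atom _).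
exact: (@rnorm_ge0 K K[i]^o).
Qed.

End Spectrum.

(** * Monomials in the algebra of formal sums *)

Section Crossed.
Variables (K : realType) (G : groupType) (J : Type).
Variable R : set (subsets G J -> K[i]).
Implicit Types (xi : subsets G J) (f : subsets G J -> K[i]) (p : expr K G J).

Lemma rnormc_mul (c d : K[i]) :
  rnorm (c * d : K[i]^o) = rnorm (c : K[i]^o) * rnorm (d : K[i]^o).
Proof. exact: (@rnormZ K K[i]^o). Qed.

Lemma rnormc_conj (c : K[i]) : rnorm (Num.conj c : K[i]^o) = rnorm (c : K[i]^o).
Proof. by apply: complexI; rewrite -!normc_rnorm; exact: norm_conjC. Qed.

Definition bounded_fun f := exists C : K, forall xi, rnorm (f xi : K[i]^o) <= C.

Lemma le_sup_norm f xi : bounded_fun f -> rnorm (f xi : K[i]^o) <= sup_norm f.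
Proof.
move=> [C fC]; apply: ub_le_sup; last by exists xi.
by exists C => _ [eta _ <-]; exact: fC.
Qed.

Lemma sup_norm_le f (C : K) : (forall xi, rnorm (f xi : K[i]^o) <= C) ->
  sup_norm f <= C.
Proof.
move=> fC; apply: ge_sup; last by move=> _ [eta _ <-]; exact: fC.
by exists (rnorm (f (fun=> true) : K[i]^o)), (fun=> true).
Qed.

Lemma sup_norm0 : sup_norm (0 : subsets G J -> K[i]) = 0.
Proof.
apply/eqP; rewrite eq_le; apply/andP; split.
  by apply: sup_norm_le => xi; rewrite -[X in rnorm X]/(0 : K[i]^o) rnorm0.
rewrite -(@rnorm0 K K[i]^o); apply: (@le_sup_norm 0 (fun=> true)).
by exists 0 => xi; rewrite -[X in rnorm X]/(0 : K[i]^o) rnorm0.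
Qed.

Lemma expr_fun_bounded p : bounded_fun (expr_fun p).
Proof.
exists (\sum_(m <- p) rnorm (m.1 : K[i]^o)) => xi; rewrite /expr_fun.
apply: le_trans (@rnorm_sum K K[i]^o _ _ _) _; apply: ler_sum => m _.
rewrite rnormc_mul -[leRHS]mulr1; apply: ler_wpM2l; first exact: rnorm_ge0.
elim: m.2 => [|x w IH]; first by rewrite big_nil /rnorm normr1.
rewrite big_cons rnormc_mul mulr_ile1 ?rnorm_ge0 // /char_fun.
by case: (xi x); rewrite /rnorm ?normr1 ?normr0.
Qed.

Definition cut_expr p (g : G) : subsets G J -> K[i] := fun xi =>
  if `[< Omega R xi /\ xi (g, None) >] then expr_fun p xi else 0.

Lemma cut_expr_ideal p g : ideal R g (cut_expr p g).
Proof.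
split; last by move=> xi nO; rewrite /cut_expr asboolF.
apply/subspace_continuousP => xi Oxi U /nbhs_singleton Uxi.
have := nbhs_cylinder (((g, None) : {classic symb G J}) :: expr_symbols p) xi.
apply: filterS => eta etaF Oeta; change (U (cut_expr p g eta)).
suff -> : cut_expr p g eta = cut_expr p g xi by [].
rewrite /cut_expr (@expr_fun_local _ _ _ _ xi); last first.
  by move=> x xp; apply: etaF; rewrite inE xp orbT.
have etag : eta (g, None) = xi (g, None) by apply: etaF; rewrite mem_head.
congr (if _ then _ else _).
by apply/asbool_equiv_eq; split=> -[_ h]; split; rewrite ?etag // -etag.
Qed.

Definition mono_cross (m : monomial K G J) : crossed_alg R :=
  delta m.2 (cut_expr [:: m.1] m.2) (cut_expr_ideal [:: m.1] m.2).

Lemma crossed_ext (a b : crossed_alg R) :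
  (forall g xi, a g xi = b g xi) -> a = b.
Proof.
move=> ab; apply: val_inj; apply/funext => g; apply/funext => xi; exact: ab.
Qed.

Lemma crossed_sumE (I : Type) (s : seq I) (F : I -> crossed_alg R) g xi :
  (\sum_(i <- s) F i : crossed_alg R) g xi = \sum_(i <- s) F i g xi.
Proof.
elim: s => [|i s IH]; first by rewrite !big_nil.
by rewrite !big_cons -IH.
Qed.

Lemma mono_crossE m g xi :
  mono_cross m g xi = if g == m.2 then cut_expr [:: m.1] m.2 xi else 0.
Proof. by rewrite /mono_cross /= /fs_delta; case: eqP. Qed.

Lemma expr_fun1 c w xi :
  expr_fun [:: (c, w)] xi = c * \prod_(x <- w) char_fun K x xi.
Proof. by rewrite /expr_fun big_seq1. Qed.

Lemma eq_mono_cross m m' : m.2 = m'.2 ->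
  (forall xi, Omega R xi -> xi (m.2, None) ->
    expr_fun [:: m.1] xi = expr_fun [:: m'.1] xi) ->
  mono_cross m = mono_cross m'.
Proof.
move=> mm E; apply: crossed_ext => g xi; rewrite !mono_crossE -mm.
by case: eqP => // _; rewrite /cut_expr; case: asboolP => // -[O1 O2]; exact: E.
Qed.

Lemma prod_move (t : G) (w : seq (symb G J)) xi :
  \prod_(x <- map (move_symb t) w) char_fun K x xi =
  \prod_(x <- w) char_fun K x (Defs.shift t^-1%g xi).
Proof.
have := expr_fun_move t [:: (1 : K[i], w)] xi.
by rewrite !expr_fun1 !mul1r.
Qed.

Lemma mono_cross_mul m m' :
  mono_cross (mono_mul m m') = mono_cross m ** mono_cross m'.
Proof.
case: m m' => [[c w] g] [[c' w'] h].
apply: crossed_ext => k xi; rewrite mono_crossE /=.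
rewrite (@fs_mul_seq _ _ _ [fset g]%fset); last first.
  by move=> l; rewrite inE /fs_delta => /negbTE ->.
rewrite big_seq_fset1 /fs_delta eqxx.
have -> : (g^-1 * k == h)%g = (k == g * h)%g.
  by apply/eqP/eqP => [<-|->]; rewrite ?mulVKg ?mulKg.
case: eqP => [kE|_]; last by rewrite mulr0.
rewrite /cut_expr !expr_fun1 big_cat big_cons prod_move /=.
have -> : Defs.shift g^-1%g xi (h, None) = xi ((g * h)%g, None).
  by rewrite /Defs.shift /= invgK.
have [[Oxi xig]|nO] := asboolP (Omega R xi /\ xi (g, None)).
  have Os := Omega_shift Oxi xig.
  have [xgh|xgh] := boolP (xi ((g * h)%g, None)).
    rewrite !asboolT // /char_fun xig mul1r mulrACA -!mulrA.
    by congr (_ * _); rewrite mulrCA.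
  by rewrite !asboolF ?mulr0 // => -[_]; apply/negP.
rewrite mul0r; have [[Oxi _]|//] := asboolP.
have [xig|xig] := boolP (xi (g, None)); first by case: nO.
by rewrite /char_fun (negbTE xig) mul0r !mulr0.
Qed.

Lemma mono_cross_star m : mono_cross (mono_star m) = star (mono_cross m).
Proof.
case: m => [[c w] g]; apply: crossed_ext => k xi; rewrite mono_crossE /=.
rewrite /fs_star /fs_delta /beta /=.
have -> : (k^-1 == g)%g = (k == g^-1)%g by rewrite -(inj_eq invg_inj) invgK.
case: eqP => [->|_]; last by rewrite conjc0.
rewrite /cut_expr !expr_fun1 prod_move invgK.
have -> : `[< Omega R xi /\ xi (g^-1%g, None) >] =
    `[< Omega R (Defs.shift g xi) /\ Defs.shift g xi (g, None) >].
  apply/asbool_equiv_eq; split=> -[O1 O2].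
    have := Omega_shift O1 O2; rewrite invgK => O3; split=> //.
    by case: O1 => -[x1 _] _; rewrite /Defs.shift /= mulVg.
  have := @shift_Omega K G J R g^-1%g xi; rewrite invgK; exact.
case: asboolP => _; last by rewrite conjc0.
rewrite rmorphM rmorph_prod; congr (_ * _); apply: eq_bigr => x _.
by rewrite /char_fun rmorph_nat.
Qed.

Definition poly_cross (l : seq (monomial K G J)) : crossed_alg R :=
  \sum_(m <- l) mono_cross m.

Definition fiber (l : seq (monomial K G J)) (g : G) : expr K G J :=
  [seq m.1 | m <- l & m.2 == g].

Lemma poly_crossE l g xi : poly_cross l g xi = cut_expr (fiber l g) g xi.
Proof.
rewrite /poly_cross crossed_sumE /cut_expr; case: asboolP => Oxi.
  rewrite /expr_fun big_map big_filter [RHS]big_mkcond; apply: eq_bigr => m _.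
  rewrite mono_crossE eq_sym; case: eqP => // mg.
  by rewrite /cut_expr asboolT ?mg // /expr_fun big_seq1.
rewrite big1 // => m _; rewrite mono_crossE; case: eqP => // mg.
by rewrite /cut_expr asboolF // -mg.
Qed.

Hypothesis R_expr : forall f, R f -> exists p : expr K G J, represents p f.

Lemma ideal_bounded g f : ideal R g f -> bounded_fun f.
Proof.
move=> [fC f0]; have [p pP] := expr_fun_dense R_expr fC ltr01.
have [C CP] := expr_fun_bounded p.
have C0 : 0 <= C by apply: le_trans (CP (fun=> true)); exact: rnorm_ge0.
exists (C + 1) => xi.
have [[Oxi _]|/f0 ->] := pselect (Omega R xi /\ xi (g, None)); last first.
  by rewrite rnorm0 addr_ge0.
have := @rnorm_triangle K K[i]^o (expr_fun p xi) (f xi) 0; rewrite !subr0.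
by have := pP _ Oxi; have := CP xi; lra.
Qed.

Lemma crossed_bounded (a : crossed_alg R) g : bounded_fun (a g).
Proof. by apply: (@ideal_bounded g); exact: formal_sum_ideal (coeffsP a). Qed.

Lemma le_crossed (a : crossed_alg R) g xi :
  rnorm (a g xi : K[i]^o) <= sup_norm (a g).
Proof. exact: le_sup_norm (crossed_bounded a g). Qed.

Lemma sup_norm_ge0 (a : crossed_alg R) g : 0 <= sup_norm (a g).
Proof. by apply: le_trans (le_crossed a g (fun=> true)); exact: rnorm_ge0. Qed.

Lemma norm1_seq (s : {fset G}) (a : crossed_alg R) :
  (forall g, g \notin s -> a g = 0) ->
  crossed_norm1 a = \sum_(g <- s) sup_norm (a g).
Proof.
move=> a0; rewrite /crossed_norm1 (fsbigTE s) // => g /a0 ->.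
exact: sup_norm0.
Qed.

Lemma crossed_supp (a : crossed_alg R) :
  exists s : {fset G}, forall g, g \notin s -> a g = 0.
Proof. exact: formal_sum_supp (coeffsP a). Qed.

(** Young's inequality for the twisted convolution: the supremum norm of each
    coefficient of a product is at most the convolution of the supremum norms
    of the coefficients, as the partial action is isometric. *)
Lemma norm1_seminorm : submult_seminorm (@crossed_norm1 K G J R).
Proof.
split.
- move=> a b; have [s a0] := crossed_supp a; have [t b0] := crossed_supp b.
  pose st := (s `|` t)%fset.
  have a0' g : g \notin st -> a g = 0 by rewrite inE negb_or => /andP[/a0].
  have b0' g : g \notin st -> b g = 0 by rewrite inE negb_or => /andP[_ /b0].
  rewrite (norm1_seq a0') (norm1_seq b0') (@norm1_seq st); last first.
    move=> g gst; rewrite -[LHS]/(coeffs a g + coeffs b g) a0' // b0' //.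
    exact: addr0.
  rewrite -big_split; apply: ler_sum => g _; apply: sup_norm_le => xi.
  apply: le_trans (@rnormD K K[i]^o _ _) _.
  by apply: lerD; exact: le_crossed.
- move=> c a; have [s a0] := crossed_supp a.
  rewrite (norm1_seq a0) (@norm1_seq s); last first.
    by move=> g gs; rewrite -[LHS]/(c *: coeffs a g) a0 // scaler0.
  rewrite mulr_sumr; apply: ler_sum => g _; apply: sup_norm_le => xi.
  rewrite -[X in rnorm X]/(c *: (a g xi : K[i]^o)) rnormZ.
  by apply: ler_wpM2l; [exact: (@rnorm_ge0 K K[i]^o) | exact: le_crossed].
- move=> a b; have [s a0] := crossed_supp a; have [t b0] := crossed_supp b.
  pose st := [fset (g * h)%g | g in s, h in t]%fset.
  have b0' k g : k \notin st -> g \in s -> b (g^-1 * k)%g = 0.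
    move=> kst gs; apply: b0; apply: contra kst => gkt.
    by apply/imfset2P; exists g => //; exists (g^-1 * k)%g; rewrite // mulVKg.
  have abE k xi : (a ** b : crossed_alg R) k xi =
      \sum_(g <- s) a g xi * b (g^-1 * k)%g (Defs.shift g^-1%g xi).
    exact: (fs_mul_seq _ _ _ a0).
  rewrite (norm1_seq a0) (@norm1_seq st); last first.
    move=> k kst; apply/funext => xi; rewrite abE big_seq big1 // => g gs.
    by rewrite (b0' k) // mulr0.
  rewrite mulr_suml.
  apply: le_trans (_ : \sum_(k <- st) \sum_(g <- s)
      sup_norm (a g) * sup_norm (b (g^-1 * k)%g) <= _).
    apply: ler_sum => k _; apply: sup_norm_le => xi; rewrite abE.
    apply: le_trans (@rnorm_sum K K[i]^o _ _ _) _; apply: ler_sum => g _.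
    rewrite rnormc_mul; apply: ler_pM; try exact: rnorm_ge0.
      exact: le_crossed.
    exact: le_crossed.
  rewrite exchange_big /= big_seq [leRHS]big_seq; apply: ler_sum => g gs.
  rewrite -mulr_sumr; apply: ler_wpM2l; first exact: sup_norm_ge0.
  rewrite /crossed_norm1 (reindex_fsbigT (fun k : G => (g^-1 * k)%g));
    last first.
    by exists (fun h => (g * h)%g) => h; rewrite ?mulKg ?mulVKg.
  rewrite (fsbigTE st) // => k kst.
  by rewrite (b0' k) //; exact: sup_norm0.
- move=> a; have [s a0] := crossed_supp a.
  have E k xi : (star a : crossed_alg R) k xi =
    Num.conj (a k^-1%g (Defs.shift k^-1%g xi)) by [].
  pose t := [fset g^-1%g | g in s]%fset.
  have a0' k : k \notin t -> a k^-1%g = 0.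
    move=> kt; apply: a0; apply: contra kt => ks.
    by apply/imfsetP; exists k^-1%g => //; rewrite invgK.
  rewrite (@norm1_seq t (star a)); last first.
    by move=> k kt; apply/funext => xi; rewrite E a0' //; exact: conjc0.
  rewrite /crossed_norm1 (reindex_fsbigT (fun k : G => k^-1%g)); last first.
    by exists (fun h => h^-1%g) => h; rewrite invgK.
  rewrite (fsbigTE t); last by move=> k kt; rewrite a0' //; exact: sup_norm0.
  apply: ler_sum => k _; apply: sup_norm_le => xi.
  by rewrite E rnormc_conj; exact: le_crossed.
Qed.

Lemma delta_sum (a : crossed_alg R) (s : {fset G}) :
  (forall g, g \notin s -> a g = 0) ->
  a = \sum_(g <- s) delta g (a g) (formal_sum_ideal g (coeffsP a)).
Proof.
move=> a0; apply: crossed_ext => h xi; rewrite crossed_sumE /= /fs_delta.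
have [hs|hs] := boolP (h \in s); last first.
  rewrite a0 // big_seq big1 // => g gs.
  by case: eqP => // hg; move: hs; rewrite hg gs.
rewrite (bigD1_seq h) ?fset_uniq //= eqxx big1 ?addr0 // => g.
by rewrite eq_sym => /negbTE ->.
Qed.

(** A formal sum is the finite sum of its components, and expressions are
    uniformly dense in each coefficient algebra. *)
Lemma poly_cross_dense (a : crossed_alg R) (eps : K) : 0 < eps ->
  exists l, crossed_norm1 (a - poly_cross l) <= eps.
Proof.
pose ok (v : crossed_alg R) := forall d : K, 0 < d ->
  exists l, crossed_norm1 (v - poly_cross l) <= d.
suff : ok a by apply.
have okD v w : ok v -> ok w -> ok (v + w).
  move=> okv okw d d0; have d20 : 0 < d / 2 by rewrite divr_gt0.
  have [l lP] := okv _ d20; have [l' lP'] := okw _ d20.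
  exists (l ++ l'); rewrite /poly_cross big_cat /= opprD addrACA.
  apply: le_trans (seminormD norm1_seminorm _ _) _.
  by rewrite (splitr d) lerD.
have ok0 : ok 0.
  move=> d d0; exists [::].
  by rewrite /poly_cross big_nil subrr (seminorm0 norm1_seminorm) ltW.
have [s a0] := crossed_supp a; rewrite (delta_sum a0).
apply: (big_ind ok) => // g _ d d0; move: (a g) (formal_sum_ideal _ _) => f fi.
have [fC f0] := fi; have [p pP] := expr_fun_dense R_expr fC d0.
exists [seq (m, g) | m <- p].
have fib : fiber [seq (m, g) | m <- p] g = p.
  rewrite /fiber filter_map -map_comp /= (eq_filter (a2 := predT)).
    by rewrite filter_predT map_id.
  by move=> m; rewrite /= eqxx.
rewrite (@norm1_seq [fset g]%fset); last first.
  move=> h; rewrite inE => hg; apply/funext => xi.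
  rewrite -[LHS]/(fs_delta g f h xi - poly_cross _ h xi) /fs_delta (negbTE hg).
  rewrite /poly_cross crossed_sumE big_map big1 ?subr0 // => m _.
  by rewrite mono_crossE (negbTE hg).
rewrite big_seq_fset1; apply: sup_norm_le => xi.
rewrite -[X in rnorm X]/(fs_delta g f g xi - poly_cross _ g xi).
rewrite /fs_delta eqxx poly_crossE fib /cut_expr.
case: asboolP => [[Oxi _]|/f0 ->]; first exact: pP.
by rewrite subrr rnorm0 ltW.
Qed.

Section Representation.
Variables (A : cstarAlgType K) (u : G -> A) (P : J -> A).
Hypothesis rel : pr_relations_R R u P.
Let rel0 : pr_relations u P := proj1 rel.

Definition poly_elt (l : seq (monomial K G J)) : A :=
  \sum_(m <- l) mono_elt u P m.

(** As [u g] is a partial isometry with range projection the one of the symbol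
    [(g, None)], multiplying by it restricts an expression to the points
    containing [g]. *)
Lemma rnorm_fiber p g :
  rnorm (expr_elt u P p ** u g) <= sup_norm (cut_expr p g).
Proof.
pose p' : expr K G J := [seq (m.1, (g, None) :: m.2) | m <- p].
have p'E : expr_elt u P p ** u g = expr_elt u P p' ** u g.
  rewrite !expr_eltE big_map !smul_suml; apply: eq_bigr => m _.
  rewrite !smulZl; congr (_ *: _) => /=; rewrite (symb_word rel0) -smulA.
  by rewrite (symbE0 rel0) (gen_partial_isometry rel0).
have u1 : rnorm (u g) <= 1.
  rewrite -(@ler_sqr _ (rnorm (u g)) 1) ?nnegrE ?rnorm_ge0 // expr1n.
  rewrite -rnorm_cstar (star_gen rel0) -{2}[g]invgK -(symbE0 rel0).
  exact: rnorm_projection (symb_projection rel0 _).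
have p'fun xi : expr_fun p' xi = char_fun K (g, None) xi * expr_fun p xi.
  rewrite /expr_fun big_map mulr_sumr; apply: eq_bigr => m _.
  by rewrite big_cons mulrCA.
have cb := ideal_bounded (cut_expr_ideal p g).
rewrite p'E; have [->|n0] := eqVneq (expr_elt u P p') 0.
  rewrite smul0l rnorm0; apply: le_trans (le_sup_norm (fun=> true) cb).
  exact: rnorm_ge0.
have [xi Oxi xiP] := rnorm_expr rel0 R_expr (proj2 rel) n0.
apply: le_trans (le_sup_norm xi cb).
have -> : cut_expr p g xi = expr_fun p' xi.
  rewrite p'fun /cut_expr /char_fun; case: (boolP (xi (g, None))) => xig.
    by rewrite asboolT // mul1r.
  by rewrite asboolF ?mul0r // => -[].
apply: le_trans (rnormM _ _) (le_trans _ xiP).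
by rewrite -[leRHS]mulr1 ler_wpM2l // rnorm_ge0.
Qed.

Lemma sum_fiber (V : nmodType) (s : seq G) (F : monomial K G J -> V) l :
  uniq s -> all (fun m => m.2 \in s) l ->
  \sum_(m <- l) F m = \sum_(g <- s) \sum_(m <- l | m.2 == g) F m.
Proof.
move=> us; elim: l => [_|m l IH /= /andP[ms /IH {}IH]].
  by rewrite big_nil big1 // => g _; rewrite big_nil.
rewrite big_cons IH (bigD1_seq m.2) //= [RHS](bigD1_seq m.2) //=.
rewrite big_cons eqxx addrA; congr (_ + _); apply: eq_bigr => g gm.
by rewrite big_cons eq_sym (negbTE gm).
Qed.

(** Grouping a polynomial by its group components turns the bound for
    expressions into a bound by the l^1-norm; in particular the element given
    by a polynomial depends only on the corresponding formal sum. *)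
Lemma rnorm_poly l : rnorm (poly_elt l) <= crossed_norm1 (poly_cross l).
Proof.
pose t := [fset g | g in [seq m.2 | m <- l]]%fset.
have lt : all (fun m : monomial K G J => m.2 \in t) l.
  rewrite -(all_map snd (fun g => g \in t)); apply/allP => g gl.
  by rewrite in_fset.
have crossE g : poly_cross l g = cut_expr (fiber l g) g.
  by apply/funext => xi; exact: poly_crossE.
rewrite (@norm1_seq t); last first.
  move=> g gt; rewrite crossE.
  have -> : fiber l g = [::].
    rewrite /fiber; elim: (l) lt => //= m l' IH /andP[mt /IH].
    by case: eqP => // mg; rewrite -mg mt in gt.
  apply/funext => xi; rewrite /cut_expr /expr_fun big_nil.
  by case: asboolP.
rewrite /poly_elt (sum_fiber _ (fset_uniq t) lt).
apply: le_trans (rnorm_sum _ _) _; apply: ler_sum => g _.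
rewrite crossE; apply: le_trans (rnorm_fiber _ _).
rewrite expr_eltE smul_suml /fiber big_map big_filter.
rewrite (eq_bigr (fun m => m.1.1 *: word_elt u P m.1.2 ** u g)) // => m /eqP mg.
by rewrite /mono_elt smulZl mg.
Qed.



End Representation.
End Crossed.

(** * The integrated form, and the covariant pair in the crossed product *)

Section Polynomials.
Variables (K : realType) (G : groupType) (J : Type).

Definition mono_scale (c : K[i]) (m : monomial K G J) : monomial K G J :=
  (c * m.1.1, m.1.2, m.2).

Section Closed.
Variables (V : starAlgType K) (F : monomial K G J -> V).
Hypothesis FM : forall m m', F (mono_mul m m') = F m ** F m'.
Hypothesis FS : forall m, F (mono_star m) = star (F m).
Hypothesis FZ : forall c m, F (mono_scale c m) = c *: F m.

Lemma poly_lin c l l' :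
  \sum_(m <- map (mono_scale c) l ++ l') F m =
  c *: (\sum_(m <- l) F m) + \sum_(m <- l') F m.
Proof.
rewrite big_cat big_map scaler_sumr; congr (_ + _).
by apply: eq_bigr => m _; rewrite FZ.
Qed.

Lemma poly_mul l l' :
  \sum_(m <- [seq mono_mul m m' | m <- l, m' <- l']) F m =
  (\sum_(m <- l) F m) ** (\sum_(m <- l') F m).
Proof.
rewrite big_allpairs_dep smul_suml; apply: eq_bigr => m _.
by rewrite smul_sumr; apply: eq_bigr => m' _.
Qed.

Lemma poly_star l :
  \sum_(m <- map (@mono_star K G J) l) F m = star (\sum_(m <- l) F m).
Proof. by rewrite big_map star_sum; apply: eq_bigr. Qed.

End Closed.

Lemma mono_elt_scale (A : cstarAlgType K) (u : G -> A) (P : J -> A) c m :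
  mono_elt u P (mono_scale c m) = c *: mono_elt u P m.
Proof. by rewrite /mono_elt /= scalerA. Qed.

(** Polynomials are built from the generators by the operations of a
    *-algebra. *)
Lemma star_hom_poly_elt (A B : cstarAlgType K) (u : G -> A) (P : J -> A)
    (v : G -> B) (Q : J -> B) (phi : A -> B) :
  star_hom phi -> (forall r, phi (u r) = v r) -> (forall i, phi (P i) = Q i) ->
  forall l, phi (poly_elt u P l) = poly_elt v Q l.
Proof.
move=> phiH pu pP l.
have pS x : phi (symb_elt u P x) = symb_elt v Q x.
  rewrite /symb_elt; case: x.2 => [i|];
  by rewrite !(star_homM phiH) ?(star_homS phiH) ?pu ?pP.
have pW w : phi (word_elt u P w) = word_elt v Q w.
  by elim: w => [|x w IH] /=; rewrite ?pu // (star_homM phiH) pS IH.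
rewrite /poly_elt (star_hom_sum phiH); apply: eq_bigr => m _.
by rewrite /mono_elt (star_homZ phiH) (star_homM phiH) pW pu.
Qed.

Let conj1E : (1 -i* 0) = 1 :> K[i]. Proof. exact: conjc1. Qed.

Variable R : set (subsets G J -> K[i]).
Hypothesis R_expr : forall f, R f -> exists p : expr K G J, represents p f.

Notation mono_cross := (mono_cross R).
Notation poly_cross := (poly_cross R).

Lemma mono_cross_scale c m : mono_cross (mono_scale c m) = c *: mono_cross m.
Proof.
apply: crossed_ext => g xi.
rewrite -[RHS]/(c * mono_cross m g xi) !mono_crossE /cut_expr.
case: eqP => _; last by rewrite mulr0.
by case: asboolP => _; rewrite ?mulr0 // /expr_fun !big_seq1 mulrA.
Qed.

(** Generators satisfying the relations represent the whole algebra of formal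
    sums: monomials multiply alike on both sides, so polynomials define the
    graph of a contractive *-homomorphism on a dense *-subalgebra. *)
Lemma integrated_form (A : cstarAlgType K) (u : G -> A) (P : J -> A) :
  pr_relations_R R u P ->
  exists rho : crossed_alg R -> A, [/\ star_hom rho,
    forall x, rnorm (rho x) <= crossed_norm1 x
    & forall l, rho (poly_cross l) = poly_elt u P l].
Proof.
move=> rel; have rel0 := proj1 rel.
pose Gam (x : crossed_alg R) (a : A) :=
  exists l, x = poly_cross l /\ a = poly_elt u P l.
have [|||||rho [rhoH rhoN rhoG]] :=
  @extend_graph K _ A _ Gam (norm1_seminorm R_expr).
- move=> c _ _ _ _ [l [-> ->]] [l' [-> ->]].
  exists (map (mono_scale c) l ++ l'); split; apply/esym.
    exact: (poly_lin mono_cross_scale).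
  exact: (poly_lin (mono_elt_scale u P)).
- move=> _ _ _ _ [l [-> ->]] [l' [-> ->]].
  exists [seq mono_mul m m' | m <- l, m' <- l']; split; apply/esym.
    exact: (poly_mul (@mono_cross_mul K G J R)).
  exact: (poly_mul (mono_elt_mul rel0)).
- move=> _ _ [l [-> ->]]; exists (map (@mono_star K G J) l); split; apply/esym.
    exact: (poly_star (@mono_cross_star K G J R)).
  exact: (poly_star (mono_elt_star rel0)).
- by move=> _ _ [l [-> ->]]; exact: rnorm_poly.
- move=> x d d0; have [l lP] := poly_cross_dense R_expr x d0.
  by exists (poly_cross l), (poly_elt u P l); split=> //; exists l.
by exists rho; split=> // l; apply: rhoG; exists l.
Qed.

Definition cross_u (r : G) : crossed_alg R := mono_cross (1, [::], r).
Definition cross_P (i : J) : crossed_alg R :=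
  mono_cross (1, [:: (1%g, Some i)], 1%g).

Lemma cross_uE r :
  cross_u r = delta r (char_Omega R (r, None)) (char_Omega_ideal0 R r).
Proof.
apply: crossed_ext => g xi; rewrite mono_crossE /= /fs_delta; case: eqP => // _.
rewrite /cut_expr expr_fun1 big_nil mulr1 /char_Omega /char_fun.
have [Oxi|nO] := asboolP (Omega R xi).
  case: (boolP (xi (r, None))) => xir; first by rewrite asboolT.
  by rewrite asboolF // => -[_]; apply/negP.
by rewrite asboolF // => -[].
Qed.

Lemma cross_PE i :
  cross_P i = delta 1%g (char_Omega R (1%g, Some i)) (char_Omega_ideal R i).
Proof.
apply: crossed_ext => g xi; rewrite mono_crossE /= /fs_delta; case: eqP => // _.
rewrite /cut_expr expr_fun1 big_seq1 mul1r /char_Omega.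
have [Oxi|nO] := asboolP (Omega R xi); last by rewrite asboolF // => -[].
by rewrite asboolT //; split=> //; case: Oxi => -[].
Qed.

Section Covariant.
Variables (B : cstarAlgType K) (iota : crossed_alg R -> B).
Hypothesis iotaH : star_hom iota.

Let v r := iota (cross_u r).
Let Q i := iota (cross_P i).
Let im (w : seq (symb G J)) := iota (mono_cross (1, w, 1%g)).


Lemma iota_symb x : symb_elt v Q x = im [:: x].
Proof.
case: x => r [i|];
  rewrite /symb_elt /= /v /Q -(star_homS iotaH) -!(star_homM iotaH);
  congr (iota _); rewrite -mono_cross_star -!mono_cross_mul;
  apply: eq_mono_cross => /=; rewrite ?mulg1 ?mulgV // => xi [[xi1 xiX] _] _.
  rewrite !expr_fun1 /= !big_cons !big_nil /= conj1E !mulr1 !mul1r.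
  rewrite /move_symb /= mulg1.
  rewrite /char_fun; case xr: (xi (r, Some i)); last by rewrite mul0r mulr0.
  by rewrite (xiX _ _ xr) !mulr1.
by rewrite !expr_fun1 /= !big_cons !big_nil /= conj1E !mulr1 !mul1r.
Qed.

Lemma iota_word w : word_elt v Q w = im w.
Proof.
elim: w => [//|x w IH] /=; rewrite iota_symb IH /im -(star_homM iotaH).
congr (iota _); rewrite -mono_cross_mul.
apply: eq_mono_cross => /=; rewrite ?mulg1 // => xi [[xi1 xiX] _] _.
rewrite !expr_fun1 /= !big_cons prod_move invg1 shift1 !mul1r mulrA.
by congr (_ * _); rewrite /char_fun xi1 mulr1.
Qed.

Lemma iota_mono m : mono_elt v Q m = iota (mono_cross m).
Proof.
rewrite /mono_elt iota_word /im /v -(star_homM iotaH) -(star_homZ iotaH).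
congr (iota _); rewrite -mono_cross_mul -mono_cross_scale.
case: m => [[c w] g]; apply: eq_mono_cross => /=; rewrite ?mul1g //.
move=> xi [[xi1 _] _] _.
rewrite !expr_fun1 big_cat big_cons big_nil /= !mulr1; congr (_ * _).
by rewrite /char_fun xi1 mulr1.
Qed.

Lemma iota_poly l : poly_elt v Q l = iota (poly_cross l).
Proof.
rewrite /poly_elt /poly_cross (star_hom_sum iotaH).
by apply: eq_bigr => m _; exact: iota_mono.
Qed.

Hypothesis iota_unit : forall x, v 1%g ** x = x /\ x ** v 1%g = x.

(** Products of monomials are monomials, so the relations of the generators
    become identities between products of characteristic functions on Omega. A
    relation in [R] becomes the vanishing of its function on Omega, the case
    [t = 1] of the definition of Omega. *)
Lemma cross_relations : pr_relations_R R v Q.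
Proof.
have im_comm w w' : im w ** im w' = im w' ** im w.
  rewrite /im -!(star_homM iotaH) -!mono_cross_mul; congr (iota _).
  apply: eq_mono_cross => //= xi _ _; rewrite !expr_fun1 !big_cat !big_cons.
  rewrite /= !prod_move invg1 shift1 !mul1r mulrCA [RHS]mulrCA.
  by congr (_ * _); rewrite mulrC.
split; last first.
  move=> f p Rf pf.
  have -> : expr_elt v Q p = iota (poly_cross [seq (m, 1%g) | m <- p]).
    rewrite -iota_poly /poly_elt big_map expr_eltE; apply: eq_bigr => m _.
    by rewrite /mono_elt (proj2 (iota_unit _)).
  rewrite -(star_hom0 iotaH); congr (iota _); apply: crossed_ext => g xi.
  rewrite poly_crossE -[RHS]/(0 : K[i]) /cut_expr.
  case: asboolP => // -[[XGxi OR] xig].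
  have [g1|g1] := eqVneq g 1%g; last first.
    rewrite /fiber filter_map /= (eq_filter (a2 := pred0)); last first.
      by move=> m /=; rewrite eq_sym (negbTE g1).
    by rewrite filter_pred0 /expr_fun big_nil.
  have -> : fiber [seq (m, 1%g) | m <- p] g = p.
    rewrite /fiber filter_map -map_comp /= g1.
    rewrite (eq_filter (a2 := predT)) ?filter_predT ?map_id // => m.
    by rewrite /= eqxx.
  have := OR 1%g (proj1 XGxi) f Rf; rewrite invg1 shift1 => <-.
  by rewrite -pf.
split=> //.
- move=> r; rewrite /v -(star_homS iotaH) -mono_cross_star; congr (iota _).
  by apply: eq_mono_cross => // xi _ _; rewrite !expr_fun1 /= conj1E.
- move=> r s; rewrite /v -!(star_homM iotaH) -!mono_cross_mul; congr (iota _).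
  apply: eq_mono_cross => //= xi _; rewrite mulgK => xir.
  rewrite !expr_fun1 /= !big_cons !big_nil /= !mul1r !mulr1.
  by rewrite [char_fun _ (r, None) _]/char_fun xir mul1r.
- move=> i; split; rewrite /Q -?(star_homS iotaH) -?(star_homM iotaH);
    congr (iota _).
    rewrite -mono_cross_star.
    apply: eq_mono_cross; rewrite /= ?invg1 // => xi _ _.
    by rewrite !expr_fun1 /= /move_symb /= mulg1 conj1E.
  rewrite -mono_cross_mul; apply: eq_mono_cross; rewrite /= ?mulg1 //.
  move=> xi [[xi1 _] _] _.
  rewrite !expr_fun1 /= !big_cons !big_nil /move_symb /= mulg1 /char_fun xi1.
  by case: (xi _); rewrite ?mul1r ?mul0r ?mulr0.
- move=> r s j; rewrite /commute_in.
  rewrite -[v r ** _]/(symb_elt v Q (r, None)).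
  by rewrite -[v s ** _ ** _]/(symb_elt v Q (s, Some j)) !iota_symb im_comm.
- move=> r s i j; rewrite /commute_in.
  rewrite -[v r ** _ ** _]/(symb_elt v Q (r, Some i)).
  by rewrite -[v s ** _ ** _]/(symb_elt v Q (s, Some j)) !iota_symb im_comm.
Qed.

End Covariant.

Lemma cross_unit x : cross_u 1%g ** x = x /\ x ** cross_u 1%g = x.
Proof.
have u1 (g : G) xi : cross_u 1%g g xi =
    if (g == 1%g) && `[< Omega R xi >] then 1 else 0.
  rewrite mono_crossE /= /cut_expr expr_fun1 big_nil mulr1.
  case: eqP => //= _; have [Oxi|nO] := asboolP (Omega R xi).
    by rewrite asboolT //; split=> //; case: Oxi => -[].
  by rewrite asboolF // => -[].
have x0 g xi : ~ (Omega R xi /\ xi (g, None)) -> x g xi = 0.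
  by case: (formal_sum_ideal g (coeffsP x)) => _; apply.
move: (cross_u 1%g) u1 => e1 u1; split; apply: crossed_ext => k xi.
  rewrite -[LHS]/(fs_mul e1 x k xi).
  rewrite (@fs_mul_seq _ _ _ [fset 1%g]%fset); last first.
    move=> g; rewrite inE => /negbTE g1; apply/funext => eta.
    by rewrite u1 g1.
  rewrite big_seq_fset1 u1 eqxx /= invg1 mul1g shift1.
  case: asboolP => [_|nO]; first by rewrite mul1r.
  by rewrite mul0r x0 // => -[].
have [s xs] := crossed_supp x.
rewrite -[LHS]/(fs_mul x e1 k xi) (fs_mul_seq _ _ _ xs).
have [ks|ks] := boolP (k \in s); last first.
  rewrite xs // big_seq big1 // => g gs; rewrite u1.
  have -> : (g^-1 * k == 1)%g = false; last by rewrite mulr0.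
  apply/eqP => gk; have kg : k = g by rewrite -[k](mulVKg g) gk mulg1.
  by rewrite kg gs in ks.
rewrite (bigD1_seq k) ?fset_uniq //= big1 ?addr0; last first.
  move=> g gk; rewrite u1.
  have -> : (g^-1 * k == 1)%g = false; last by rewrite mulr0.
  apply/eqP => gk1; have kg : k = g by rewrite -[k](mulVKg g) gk1 mulg1.
  by rewrite kg eqxx in gk.
rewrite u1 mulVg eqxx /=.
have [[Oxi xik]|nO] := pselect (Omega R xi /\ xi (k, None)).
  by rewrite asboolT ?mulr1 //; exact: Omega_shift.
by rewrite x0 // mul0r.
Qed.

End Polynomials.

(** * The isomorphism *)

Lemma dense_unit (K : realType) (V : starAlgType K) (B : cstarAlgType K)
    (iota : V -> B) (one : V) :
  star_hom iota -> dense (range iota) ->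
  (forall x, one ** x = x /\ x ** one = x) ->
  forall b, iota one ** b = b /\ b ** iota one = b.
Proof.
move=> iotaH iotaD oneP b; pose c := rnorm (iota one) + 1.
have c0 : 0 < c by rewrite ltr_wpDl // rnorm_ge0.
have near_b (d : K) : 0 < d -> exists x, rnorm (b - iota x) <= d / c.
  move=> d0; have [|_ [x _ <-] bx] := rnorm_dense iotaD b (e := d / c).
    by rewrite divr_gt0.
  by exists x; exact: ltW.
have cE (d : K) : d = rnorm (iota one) * (d / c) + d / c.
  by rewrite -[X in _ + X]mul1r -mulrDl mulrC divfK // gt_eqF.
split; apply: eq_rnorm_eps => d d0; have [x xP] := near_b _ d0.
  have -> : iota one ** b - b = iota one ** (b - iota x) + (iota x - b).
    by rewrite smulBr -(star_homM iotaH) (proj1 (oneP x)) addrA subrK.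
  apply: le_trans (rnormD _ _) _; rewrite [leRHS]cE (rnormB (iota x)) lerD //.
  by apply: le_trans (rnormM _ _) _; rewrite ler_wpM2l // rnorm_ge0.
have -> : b ** iota one - b = (b - iota x) ** iota one + (iota x - b).
  by rewrite smulBl -(star_homM iotaH) (proj2 (oneP x)) addrA subrK.
apply: le_trans (rnormD _ _) _; rewrite [leRHS]cE (rnormB (iota x)) lerD //.
by apply: le_trans (rnormM _ _) _; rewrite mulrC ler_wpM2l // rnorm_ge0.
Qed.

(** The universal property of the enveloping C*-algebra, for representations
    in a C*-algebra: [rho] is one of the competitors in the supremum that
    defines the norm of [iota x], so [iota x |-> rho x] is well defined and
    contractive on a dense *-subalgebra. *)
Lemma enveloping_extend (K : realType) (V : starAlgType K) (N : V -> K)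
    (B A : cstarAlgType K) (iota : V -> B) (rho : V -> A) :
  is_enveloping N iota -> star_hom rho -> (forall x, rnorm (rho x) <= N x) ->
  exists psi : B -> A, [/\ star_hom psi, forall b, rnorm (psi b) <= rnorm b
    & forall x, psi (iota x) = rho x].
Proof.
move=> [iotaH iotaD iotaN] rhoH rhoN.
have rho_iota x : rnorm (rho x) <= rnorm (iota x).
  rewrite iotaN; apply: ub_le_sup; last by exists A, rho.
  by exists (N x) => _ [C [pi [_ piN ->]]]; exact: piN.
pose Gam b a := exists x, b = iota x /\ a = rho x.
have [|||||psi [psiH psiN psiG]] :=
  @extend_graph K B A _ Gam (rnorm_seminorm B).
- move=> c _ _ _ _ [x [-> ->]] [y [-> ->]]; exists (c *: x + y).
  rewrite (star_homD iotaH) (star_homZ iotaH) (star_homD rhoH).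
  by rewrite (star_homZ rhoH).
- move=> _ _ _ _ [x [-> ->]] [y [-> ->]]; exists (x ** y).
  by rewrite (star_homM iotaH) (star_homM rhoH).
- move=> _ _ [x [-> ->]]; exists (star x).
  by rewrite (star_homS iotaH) (star_homS rhoH).
- by move=> _ _ [x [-> ->]].
- move=> b d d0; have [_ [x _ <-] bx] := rnorm_dense iotaD b d0.
  by exists (iota x), (rho x); split; [exists x | exact: ltW].
by exists psi; split=> // x; apply: psiG; exists x.
Qed.

(** The norm of [iota x] is the supremum of a set inhabited by [rnorm (rho x)],
    all of whose elements are at most [N x]. *)
Lemma enveloping_contractive (K : realType) (V : starAlgType K) (N : V -> K)
    (B A : cstarAlgType K) (iota : V -> B) (rho : V -> A) :
  is_enveloping N iota -> star_hom rho -> (forall x, rnorm (rho x) <= N x) ->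
  forall x, rnorm (iota x) <= N x.
Proof.
move=> [_ _ iotaN] rhoH rhoN x; rewrite iotaN; apply: ge_sup.
  by exists (rnorm (rho x)), A, rho.
by move=> _ [C [pi [_ piN ->]]]; exact: piN.
Qed.

Theorem theorem4p3 (K : realType) (G : groupType) (J : Type)
    (R : set (subsets G J -> K[i]))
    (R_expr : forall f, R f -> exists p : expr K G J, represents p f)
    (A : cstarAlgType K) (u : G -> A) (P : J -> A)
    (A_univ : is_Cpr R u P)
    (B : cstarAlgType K) (iota : crossed_alg R -> B)
    (B_env : is_partial_crossed_product iota) :
  exists phi : A -> B,
    [/\ star_iso phi,
        forall r : G, phi (u r) =
          iota (delta r (char_Omega R (r, None)) (char_Omega_ideal0 R r))
      & forall i : J, phi (P i) =
          iota (delta 1%g (char_Omega R (1%g, Some i)) (char_Omega_ideal R i))].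
Proof.
have [relA univ] := A_univ; have [iotaH iotaD _] := B_env.
have unitB := dense_unit iotaH iotaD (@cross_unit K G J R).
have relB := cross_relations iotaH unitB.
have [phi [[phiH phiu phiP] _]] := univ _ _ _ relB.
have [rho [rhoH rhoN rhoE]] := integrated_form R_expr relA.
have [psi [psiH psiN psiE]] := enveloping_extend B_env rhoH rhoN.
have iotaN := enveloping_contractive B_env rhoH rhoN.
have poly_cross1 m : poly_cross R [:: m] = mono_cross R m.
  by rewrite /poly_cross big_seq1.
have rho_u r : rho (cross_u R r) = u r.
  rewrite /cross_u -poly_cross1 rhoE /poly_elt big_seq1 /mono_elt /= scale1r.
  by rewrite (gen1l (proj1 relA)).
have rho_P i : rho (cross_P R i) = P i.
  rewrite /cross_P -poly_cross1 rhoE /poly_elt big_seq1 /mono_elt /= scale1r.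
  by rewrite !(gen1r (proj1 relA)) (symb1 (proj1 relA)).
have phiK : cancel phi psi.
  have [id' [_ uniq_id]] := univ _ _ _ relA => a.
  have E : id' = psi \o phi.
    apply: uniq_id; split; first exact: star_hom_comp.
    - by move=> r /=; rewrite phiu psiE rho_u.
    - by move=> i /=; rewrite phiP psiE rho_P.
  rewrite -[LHS]/((psi \o phi) a) -E.
  by have -> : id' = id by apply: uniq_id; split=> //; split.
(* [phi] comes from a purely algebraic universal property; its continuity is
   automatic. *)
have phiN a : rnorm (phi a) <= rnorm a.
  exact: star_hom_contractive (pr_unit (proj1 relA)) phiH a.
have phiE l : phi (psi (iota (poly_cross R l))) = iota (poly_cross R l).
  by rewrite psiE rhoE (star_hom_poly_elt phiH phiu phiP) iota_poly.
(* [phi \o psi] is contractive and fixes the image of every polynomial. *)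
have psiK : cancel psi phi.
  move=> b; apply: eq_rnorm_eps => d d0.
  have d40 : 0 < d / 4 by rewrite divr_gt0.
  have [_ [x _ <-] bx] := rnorm_dense iotaD b d40.
  have [l xl] := poly_cross_dense R_expr x d40.
  set y := iota (poly_cross R l).
  have by_ : rnorm (b - y) <= d / 2.
    have := rnorm_triangle (iota x) b y; have := iotaN (x - poly_cross R l).
    by rewrite (star_homB iotaH) -/y; lra.
  have := rnorm_triangle y (phi (psi b)) b.
  have -> : phi (psi b) - y = phi (psi (b - y)).
    by rewrite (star_homB psiH) (star_homB phiH) [phi (psi y)]phiE.
  rewrite (rnormB y).
  have := phiN (psi (b - y)); have := psiN (b - y).
  by lra.
exists phi; split; first by split=> //; exists psi.
- by move=> r; rewrite phiu cross_uE.
- by move=> i; rewrite phiP cross_PE.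
Qed.
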